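(* There is a conditional expectation $E:P(P_\omega)\to F(P_\omega)$ from the C*-algebra $(P(P_\omega),\circ)$ onto its C*-subalgebra $(F(P_\omega),\circ)$.
   Context: $H$ is a separable Hilbert space with orthonormal basis $\{e_i: i\in\Theta\}$, where $\Theta=\{1,\dots,n\}$ with $n>1$, or $\Theta=\mathbb{N}$. $\mathcal{F}(H)=\bigoplus_{n\ge 0}H^{\otimes n}$ is the full Fock space, with $H^{\otimes 0}=\mathbb{C}\Omega$, $\Omega$ a unit (vacuum) vector. For $\xi\in H$, $l_\xi$ is the left creation operator on $\mathcal{F}(H)$, $l_\xi(\eta)=\xi\otimes\eta$ (with $l_\xi\Omega=\xi$), and $l_i=l_{e_i}$. $\omega=(\omega_i)_{i\in\Theta}$ is a family of positive reals with $\sum_{i\in\Theta}\omega_i=1$, and $P_\omega:B(\mathcal{F}(H))\to B(\mathcal{F}(H))$ is the normal unital completely positive map $P_\omega(x)=\sum_{i\in\Theta}\omega_i\, l_i^*xl_i$. For $\lambda\in\mathbb{T}$ (unit circle), $E_\lambda(P_\omega)=\{x: P_\omega(x)=\lambda x\}$. The Poisson boundary is $F(P_\omega)=E_1(P_\omega)$. The peripheral Poisson boundary $P(P_\omega)$ is the norm-closed linear span in $B(\mathcal F(H))$ of $\bigcup_{\lambda\in\mathbb{T}}E_\lambda(P_\omega)$. It is known (Bhat–Kar–Talwar) that $P(P_\omega)$ is a unital C*-algebra with the operator norm, the usual adjoint, unit $1$, and the modified Choi–Effros product $\circ$, the unique norm-continuous bilinear map on $P(P_\omega)$ such that $x\circ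 y=\text{SOT-}\lim_{m\to\infty}(\lambda\mu)^{-m}P_\omega^m(xy)$ for $x\in E_\lambda(P_\omega)$, $y\in E_\mu(P_\omega)$. Restricted to $F(P_\omega)$, $\circ$ is the Choi–Effros product, and $F(P_\omega)$ is a C*-subalgebra of $(P(P_\omega),\circ)$ (and a von Neumann algebra). A conditional expectation of a C*-algebra $B$ onto a C*-subalgebra $A$ is a completely positive contractive linear map $E:B\to A$ with $E(a)=a$ for all $a\in A$ (equivalently, a norm-one projection of $B$ onto $A$). *)

(* Defs.v *)
(* The scalars are C = R[i] for R : realType. *)
From HB Require Import structures.
From mathcomp Require Import all_boot all_order all_algebra.
From mathcomp Require Import all_classical all_reals all_analysis.
From mathcomp Require Import complex.

Set Implicit Arguments.
Unset Strict Implicit.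
Unset Printing Implicit Defensive.

Import Order.TTheory GRing.Theory Num.Theory.
Import numFieldNormedType.Exports.

Local Open Scope classical_set_scope.
Local Open Scope ring_scope.
Local Open Scope complex_scope.

Definition lspan (K : nzRingType) (V : lmodType K) (A : set V) : set V :=
  [set y | exists n (c : 'I_n -> K) (x : 'I_n -> V),
     (forall k, A (x k)) /\ y = \sum_(k < n) c k *: x k].

Section CStar.
Variables (C : nzRingType) (V : lmodType C) (R : numDomainType).
Variables (mul : V -> V -> V) (star : V -> V) (nrm : V -> R).

(* [X = Z^* Z] in the *-algebra M_n(A), where A is a C*-algebra with product
   [mul] and involution [star]. *)
Definition mx_positive (A : set V) (n : nat) (X : 'M[V]_n) : Prop :=
  exists Z : 'M[V]_n, (forall i j, A (Z i j)) /\
    X = \matrix_(i, j) \sum_(k < n) mul (star (Z k i)) (Z k j).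

Definition completely_positive (B A : set V) (E : V -> V) : Prop :=
  forall (n : nat) (X : 'M[V]_n),
    mx_positive B X -> mx_positive A (map_mx E X).

(* Only the values of [E] on [B] matter. *)
Definition conditional_expectation (B A : set V) (E : V -> V) : Prop :=
  [/\ forall x, B x -> A (E x),
      forall (a : C) x y, B x -> B y -> E (a *: x + y) = a *: E x + E y,
      completely_positive B A E,
      forall x, B x -> nrm (E x) <= nrm x &
      forall x, A x -> E x = x].

End CStar.

(* Inner products are linear in the first variable and conjugate-linear in the
   second one. A Hilbert space is a complete normed space over C whose norm is
   induced by an inner product. *)
Definition hilbert (R : realType) (F : completeNormedModType R[i])
    (dF : {dot F for Num.Def.conjC}) : Prop :=
  forall v : F, `|v| ^+ 2 = dF v v.

Definition orthonormal_basis (R : realType) (H : completeNormedModType R[i])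
    (dH : {dot H for Num.Def.conjC}) (Theta : set nat) (e : nat -> H) : Prop :=
  (forall i j, Theta i -> Theta j -> dH (e i) (e j) = (i == j)%:R) /\
  closure (lspan (e @` Theta)) = setT.

(* [F] is the full Fock space of [H], i.e. the Hilbert direct sum of the Hilbert
   tensor powers of [H]: [tens [:: x1; ..; xn]] is the elementary tensor
   x1 (x) .. (x) xn in the n-th summand, and [tens [::]] is the vacuum vector.
   These conditions determine (F, tens) up to a unique unitary. *)
Definition full_fock (R : realType) (H F : completeNormedModType R[i])
    (dH : {dot H for Num.Def.conjC}) (dF : {dot F for Num.Def.conjC}) (tens : seq H -> F) :
    Prop :=
  [/\ forall (s t : seq H) (a : R[i]) (x y : H),
        tens (s ++ (a *: x + y) :: t) =
        a *: tens (s ++ x :: t) + tens (s ++ y :: t),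
      forall s t : seq H, dF (tens s) (tens t) =
        if size s == size t then \prod_(p <- zip s t) dH p.1 p.2 else 0 &
      closure (lspan (range tens)) = setT].

Section Operators.
Variables (R : realType) (F : completeNormedModType R[i]).
Variable dF : {dot F for Num.Def.conjC}.

Definition bounded_op : set (F -> F) :=
  [set T | linear T /\ exists M : R, forall v, `|T v| <= M%:C * `|v|].

(* The norm of [F] takes its (real) values in C. *)
Definition opnorm (T : F -> F) : R :=
  sup [set complex.Re `|T v| | v in [set v : F | `|v| <= 1]].

Definition adjoint (T : F -> F) (v : F) : F :=
  get [set z | forall u, dF (T u) v = dF u z].

Definition left_creation (H : completeNormedModType R[i]) (tens : seq H -> F)
    (l : H -> F -> F) : Prop :=
  forall xi, bounded_op (l xi) /\ forall s, l xi (tens s) = tens (xi :: s).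

(* The sum over i in Theta converges pointwise (SOT). *)
Definition P_omega (Theta : set nat) (omega : nat -> R) (l : nat -> F -> F)
    (x : F -> F) (v : F) : F :=
  lim ((\sum_(i < n | (i : nat) \in Theta)
          (omega i)%:C *: adjoint (l i) (x (l i v))) @[n --> \oo]).

Variable P : (F -> F) -> (F -> F).

Definition eigenspace (lambda : R[i]) : set (F -> F) :=
  [set x | bounded_op x /\ P x = lambda *: x].

Definition poisson_boundary : set (F -> F) := eigenspace 1.

Definition peripheral_boundary : set (F -> F) :=
  [set x | bounded_op x /\ forall eps : R, 0 < eps ->
     exists2 y, lspan [set z | exists2 lambda : R[i], `|lambda| = 1 &
                                eigenspace lambda z] y &
                opnorm (x - y) < eps].

(* The last condition says that [circ x y] is the SOT-limit of
   (lambda mu)^-m P^m (x y). *)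
Definition modified_choi_effros (circ : (F -> F) -> (F -> F) -> (F -> F)) :
    Prop :=
  let B := peripheral_boundary in
  [/\ forall x y, B x -> B y -> B (circ x y),
      (forall a x x' y, B x -> B x' -> B y ->
         circ (a *: x + x') y = a *: circ x y + circ x' y) /\
      (forall a x y y', B x -> B y -> B y' ->
         circ x (a *: y + y') = a *: circ x y + circ x y'),
      forall x y, B x -> B y -> forall eps : R, 0 < eps ->
        exists2 delta : R, 0 < delta & forall x' y', B x' -> B y' ->
          opnorm (x' - x) < delta -> opnorm (y' - y) < delta ->
          opnorm (circ x' y' - circ x y) < eps &
      forall (lambda mu : R[i]) x y, `|lambda| = 1 -> `|mu| = 1 ->
        eigenspace lambda x -> eigenspace mu y ->
        forall v, ((lambda * mu) ^- m *: iter m P (x \o y) v) @[m --> \oo]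
                    --> circ x y v].

End Operators.

(* Main.v *)
Require Import Defs.
From HB Require Import structures.
From mathcomp Require Import all_boot all_order all_algebra.
From mathcomp Require Import all_classical all_reals all_analysis.
From mathcomp Require Import complex ring lra.

Set Implicit Arguments.
Unset Strict Implicit.
Unset Printing Implicit Defensive.

Import Order.TTheory GRing.Theory Num.Theory.
Import numFieldNormedType.Exports.

Local Open Scope classical_set_scope.
Local Open Scope ring_scope.
Local Open Scope complex_scope.

(* The expectation is the limit of the Cesaro means of the iterates of P: on an
   eigenspace of P for lambda on the unit circle the means tend in norm to the
   identity if lambda = 1 and to 0 otherwise, and they are contractions, so
   they converge on the closed span of the eigenspaces.

   Complete positivity: a matrix (z_i^* o z_j) is positive as an operator on
   F^n, being a limit of P^m (w_i^* w_j); this is preserved by the means. It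
   remains to write a positive matrix X over the Poisson boundary as W^* o W
   there. After scaling, Y = 1 - X is self-adjoint with norm at most 1, and the
   iteration S <- (Y + S o S) / 2 converges to some T with (1 - T) o (1 - T) = X.

   P enters only through its weak form: <P x u, v> is the sum over i of
   omega_i <x l_i u, l_i v>, where the l_i are isometries. *)

(** Complete positivity asks for a factorization W^* o W over the Poisson boundary itself, for a
    product known only through pointwise limits. Positivity is therefore carried as nonnegativity of
    the quadratic form of an operator matrix on F^n, a condition that survives P, sums and pointwise
    limits, and it is turned back into a factorization once, at the end. The root iteration comes
    from rewriting (1 - T) o (1 - T) = 1 - Y as T = (Y + T o T) / 2. Norm 1 is the borderline case,
    with no strict contraction: the scalar iteration s <- (1 + s^2) / 2 has 1 as a double fixed
    point and approaches it only at rate 2 / k. It is increasing, however, and its increments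
    majorize in norm those of S, so S is Cauchy. Inner products are handled through their real
    parts; the complex value is recovered by testing against ['i *: v]. *)

Lemma cvg_le (R : realType) (f : nat -> R) l c :
  f n @[n --> \oo] --> l -> (forall n, f n <= c) -> l <= c.
Proof.
by move=> hf h; apply: (ler_cvg_to hf (cvg_cst c)); apply: nearW => n; exact: h.
Qed.

Lemma cvg_dist_bound (R : realType) (f c : nat -> R) l :
  (forall n, `|f n - l| <= c n) -> c n @[n --> \oo] --> (0 : R) ->
  f n @[n --> \oo] --> l.
Proof.
move=> h hc; apply/subr_cvg0.
apply: (@norm_cvg0 _ _ _ _ _ (fun n => f n - l)).
by apply: (squeeze_cvgr _ (cvg_cst 0) hc); apply: nearW => n; rewrite normr_ge0 h.
Qed.

Lemma cvg0Mr (R : realType) (f : nat -> R) (M : R) :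
  f n @[n --> \oo] --> (0 : R) -> f n * M @[n --> \oo] --> (0 : R).
Proof. by move=> h; rewrite -[X in _ --> X](mul0r M); exact: cvgMr_tmp. Qed.

(** * The real inner product and real-valued norm of a complex Hilbert space *)

Section RealInnerProduct.
Variables (R : realType) (F : completeNormedModType R[i]).
Variables (dF : {dot F for Num.Def.conjC}) (HF : hilbert dF).

Definition nr (v : F) : R := complex.Re `|v|.
Definition rd (u v : F) : R := complex.Re (dF u v).

Lemma normE v : `|v| = (nr v)%:C.
Proof. by rewrite /nr RRe_real // normr_real. Qed.

Lemma nr_ge0 v : 0 <= nr v.
Proof. by rewrite -ler0c -normE normr_ge0. Qed.

Lemma nr0 : nr 0 = 0.
Proof. by rewrite /nr normr0. Qed.

Lemma nr0_eq0 v : nr v = 0 -> v = 0.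
Proof. by move=> h; apply/normr0_eq0; rewrite normE h. Qed.

Lemma nrD u v : nr (u + v) <= nr u + nr v.
Proof. by rewrite -lecR rmorphD /= -!normE ler_normD. Qed.

Lemma nrN v : nr (- v) = nr v.
Proof. by rewrite /nr normrN. Qed.

Lemma nrC u v : nr (u - v) = nr (v - u).
Proof. by rewrite -nrN opprB. Qed.

Lemma nrZ a v : nr (a *: v) = complex.Re `|a| * nr v.
Proof.
apply: complexI; rewrite rmorphM /= -!normE normrZ; congr (_ * _).
Qed.

Lemma nrZr (a : R) v : nr (a%:C *: v) = `|a| * nr v.
Proof. by rewrite nrZ normc_def /= expr0n /= addr0 sqrtr_sqr. Qed.

Lemma nr_sum (I : Type) (s : seq I) (P : pred I) (f : I -> F) :
  nr (\sum_(i <- s | P i) f i) <= \sum_(i <- s | P i) nr (f i).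
Proof.
elim/big_rec2: _ => [|i y x _ h]; first by rewrite nr0.
by rewrite (le_trans (nrD _ _)) // lerD2l.
Qed.

Lemma rdDl u v w : rd (u + v) w = rd u w + rd v w.
Proof. by rewrite /rd linearDl raddfD. Qed.

Lemma rdC u v : rd u v = rd v u.
Proof. by rewrite /rd hermC expr0 mul1r /=; case: (dF v u). Qed.

Lemma rdDr u v w : rd w (u + v) = rd w u + rd w v.
Proof. by rewrite rdC rdDl !(rdC w). Qed.

Lemma rdZl (a : R) u v : rd (a%:C *: u) v = a * rd u v.
Proof. by rewrite /rd linearZl_LR /=; case: (dF u v) => x y /=; rewrite mul0r subr0. Qed.

Lemma rdZr (a : R) u v : rd u (a%:C *: v) = a * rd u v.
Proof. by rewrite rdC rdZl rdC. Qed.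

Lemma rdZJ (a : R[i]) u v : rd (a *: u) v = rd u (conjc a *: v).
Proof.
rewrite /rd linearZl_LR /= linearZr_LR /=; congr (complex.Re (_ * _)).
by rewrite -[conjc a]/(Num.conj a) conjCK.
Qed.

Lemma rdZrJ (a : R[i]) u v : rd u (a *: v) = rd (conjc a *: u) v.
Proof. by rewrite rdZJ -![conjc _]/(Num.conj _) conjCK. Qed.

Lemma rdNl u v : rd (- u) v = - rd u v.
Proof. by rewrite -scaleN1r -[-1]/(- (1 : R)%:C) -rmorphN rdZl mulN1r. Qed.

Lemma rdNr u v : rd u (- v) = - rd u v.
Proof. by rewrite rdC rdNl rdC. Qed.

Lemma rdBl u v w : rd (u - v) w = rd u w - rd v w.
Proof. by rewrite rdDl rdNl. Qed.

Lemma rdBr u v w : rd w (u - v) = rd w u - rd w v.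
Proof. by rewrite rdDr rdNr. Qed.

Lemma rd0l v : rd 0 v = 0.
Proof. by rewrite /rd linear0l. Qed.

Lemma rd0r v : rd v 0 = 0.
Proof. by rewrite rdC rd0l. Qed.

Lemma rd_suml (I : Type) (s : seq I) (P : pred I) (f : I -> F) v :
  rd (\sum_(i <- s | P i) f i) v = \sum_(i <- s | P i) rd (f i) v.
Proof. by elim/big_rec2: _ => [|i y x _ h]; rewrite ?rd0l // rdDl h. Qed.

Lemma rd_sumr (I : Type) (s : seq I) (P : pred I) (f : I -> F) v :
  rd v (\sum_(i <- s | P i) f i) = \sum_(i <- s | P i) rd v (f i).
Proof. by rewrite rdC rd_suml; apply: eq_bigr => i _; rewrite rdC. Qed.

Lemma rdvv v : rd v v = nr v ^+ 2.
Proof. by rewrite /rd -HF normE -rmorphXn. Qed.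

(** Cauchy-Schwarz: the squared norm of |v| u - |u| v expands to 2 |u|^2 |v|^2 - 2 |u| |v| [rd u v],
    and |u| |v| is divided out. *)
Lemma rd_le u v : rd u v <= nr u * nr v.
Proof.
have [u0|u0] := eqVneq (nr u) 0; first by rewrite (nr0_eq0 u0) rd0l nr0 mul0r.
have up : 0 < nr u by rewrite lt_def u0 nr_ge0.
have := sqr_ge0 (nr ((nr v)%:C *: u - (nr u)%:C *: v)).
rewrite -rdvv !(rdBl, rdBr, rdZl, rdZr) !rdvv (rdC v u) => h.
have [v0|v0] := eqVneq (nr v) 0; first by rewrite (nr0_eq0 v0) rd0r nr0 mulr0.
have vp : 0 < nr v by rewrite lt_def v0 nr_ge0.
have uvp : 0 < nr u * nr v by rewrite mulr_gt0.
rewrite -(ler_pM2l uvp); nra.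
Qed.

Lemma abs_rd_le u v : `|rd u v| <= nr u * nr v.
Proof. by rewrite ler_norml rd_le lerNl -rdNl (le_trans (rd_le _ _)) // nrN. Qed.

Lemma rd_eq u v : (forall w, rd u w = rd v w) -> u = v.
Proof.
move=> h; apply/eqP; rewrite -subr_eq0; apply/eqP/nr0_eq0/eqP.
by rewrite -sqrf_eq0 -rdvv rdBl h subrr.
Qed.

(** Conjugate-linearity in the second variable turns ['i *: v] into a factor -i, whose effect is to
    move the imaginary part into the real one. *)
Lemma dF_rd u v : dF u v = rd u v +i* rd u ('i *: v).
Proof.
rewrite {2}/rd linearZr_LR /=; rewrite /rd -complexiE; case: (dF u v) => x y /=.
by congr (_ +i* _); ring.
Qed.

Lemma cvg_nrP (u : nat -> F) l :
  u n @[n --> \oo] --> l <-> nr (u n - l) @[n --> \oo] --> (0 : R).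
Proof.
split=> [/cvgrPdist_lt h|/cvgrPdist_lt h]; apply/cvgrPdist_lt => e e0.
  have := h e%:C; rewrite ltcR => /(_ e0); apply: filterS => n.
  by rewrite normE ltcR nrC sub0r normrN ger0_norm ?nr_ge0.
(* The radii of balls in F are positive elements of C, hence real. *)
have [e1 /RRe_real e2] : 0 < complex.Re e /\ e \is Num.real.
  by split; [move: e0; rewrite ltcE => /andP[] | rewrite gtr0_real].
have := h _ e1; apply: filterS => n.
by rewrite sub0r normrN ger0_norm ?nr_ge0 // normE -e2 ltcR nrC.
Qed.

Lemma cvg_nr_cauchy (u : nat -> F) :
  (forall e : R, 0 < e -> exists N, forall m n,
     (N <= m)%N -> (N <= n)%N -> nr (u m - u n) < e) -> cvgn u.
Proof.
move=> h; apply/cauchy_cvgP/cauchy_ballP => e e0.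
have [e1 /RRe_real e2] : 0 < complex.Re e /\ e \is Num.real.
  by split; [move: e0; rewrite ltcE => /andP[] | rewrite gtr0_real].
have [N hN] := h _ e1.
pose S := [set n | (N <= n)%N].
exists (u @` S, u @` S).
  by split; exists N => // n hn; exists n.
by move=> [_ _] [/= [m hm <-] [n hn <-]]; rewrite -ball_normE /= normE -e2 ltcR hN.
Qed.

Lemma cvg_nr_bound (u : nat -> F) l (c : nat -> R) :
  (forall n, nr (u n - l) <= c n) -> c n @[n --> \oo] --> (0 : R) ->
  u n @[n --> \oo] --> l.
Proof.
move=> h hc; apply/cvg_nrP.
apply: (squeeze_cvgr _ (cvg_cst 0) hc).
by apply: nearW => n; rewrite nr_ge0 h.
Qed.

Lemma cvg_rdl (u : nat -> F) l v :
  u n @[n --> \oo] --> l -> rd (u n) v @[n --> \oo] --> rd l v.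
Proof.
move=> /cvg_nrP /(@cvg0Mr _ _ (nr v)); apply: cvg_dist_bound => n.
by rewrite -rdBl abs_rd_le.
Qed.

Lemma cvg_nr (u : nat -> F) l :
  u n @[n --> \oo] --> l -> nr (u n) @[n --> \oo] --> nr l.
Proof.
move=> /cvg_nrP; apply: cvg_dist_bound => n; rewrite ler_norml.
have := nrD (u n - l) l; have := nrD (l - u n) (u n); rewrite !subrK (nrC l).
by move=> h1 h2; apply/andP; split; lra.
Qed.

End RealInnerProduct.

(** * Bounded operators, Riesz representation and adjoints *)

Section BoundedOperators.
Variables (R : realType) (F : completeNormedModType R[i]).
Variables (dF : {dot F for Num.Def.conjC}) (HF : hilbert dF).
Local Notation rd := (rd dF).

(** Some bound rather than the least one: such bounds pass to pointwise limits and to P without any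
    supremum. *)
Definition opb (x : F -> F) (M : R) : Prop := forall v, nr (x v) <= M * nr v.

Lemma opb_le x M M' : opb x M -> M <= M' -> opb x M'.
Proof. by move=> h h' v; rewrite (le_trans (h v)) // ler_wpM2r // nr_ge0. Qed.

Lemma bounded_opP (x : F -> F) :
  bounded_op x <-> linear x /\ exists2 M, 0 <= M & opb x M.
Proof.
split=> -[lx [M]].
  move=> h; split=> //; exists (Num.max 0 M); first by rewrite le_max lexx.
  move=> v; apply: (@le_trans _ _ (M * nr v)).
    by have := h v; rewrite !normE -rmorphM lecR.
  by rewrite ler_wpM2r ?nr_ge0 // le_max lexx orbT.
by move=> M0 h; split=> //; exists M => v; rewrite !normE -rmorphM lecR.
Qed.

Section LinearMaps.
Variables (x : F -> F) (lx : linear x).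
Lemma linD u v : x (u + v) = x u + x v.
Proof. by have := lx 1 u v; rewrite !scale1r. Qed.
Lemma lin0 : x 0 = 0.
Proof. by have := linD 0 0; rewrite addr0 => /eqP; rewrite -subr_eq subrr => /eqP. Qed.
Lemma linZ a u : x (a *: u) = a *: x u.
Proof. by have := lx a u 0; rewrite lin0 !addr0. Qed.
Lemma linN u : x (- u) = - x u.
Proof. by rewrite -scaleN1r linZ scaleN1r. Qed.
Lemma linB u v : x (u - v) = x u - x v.
Proof. by rewrite linD linN. Qed.
Lemma lin_sum (I : Type) (s : seq I) (P : pred I) (f : I -> F) :
  x (\sum_(i <- s | P i) f i) = \sum_(i <- s | P i) x (f i).
Proof. by elim/big_rec2: _ => [|i y1 y2 _ h]; rewrite ?lin0 // linD h. Qed.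
End LinearMaps.

Lemma bounded_lin (x : F -> F) : bounded_op x -> linear x.
Proof. by case. Qed.

Lemma bounded_id : bounded_op (id : F -> F).
Proof.
by apply/bounded_opP; split=> //; exists 1 => // v; rewrite mul1r.
Qed.

Lemma bounded_comp (x y : F -> F) :
  bounded_op x -> bounded_op y -> bounded_op (x \o y).
Proof.
move=> /bounded_opP[lx [M M0 hx]] /bounded_opP[ly [N N0 hy]]; apply/bounded_opP.
split; first by move=> a u v /=; rewrite ly lx.
exists (M * N); first exact: mulr_ge0.
by move=> v /=; rewrite (le_trans (hx _)) // -mulrA ler_wpM2l.
Qed.

Lemma bounded_scaleD (a : R[i]) (x y : F -> F) :
  bounded_op x -> bounded_op y -> bounded_op (a *: x + y).
Proof.
move=> /bounded_opP[lx [M M0 hx]] /bounded_opP[ly [N N0 hy]]; apply/bounded_opP.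
split.
  move=> b u v; rewrite !fctE lx ly !scalerDr !scalerA (mulrC a) -!addrA.
  by congr (_ + _); rewrite addrCA.
exists (complex.Re `|a| * M + N).
  by rewrite addr_ge0 // mulr_ge0 // -ler0c RRe_real ?normr_real.
move=> v; rewrite !fctE (le_trans (nrD _ _)) // nrZ mulrDl lerD // -mulrA.
by rewrite ler_wpM2l // -ler0c RRe_real ?normr_real.
Qed.

Lemma bounded0 : bounded_op (0 : F -> F).
Proof.
apply/bounded_opP; split.
  by move=> a u v; rewrite -[LHS]/(0 : F) -[0 in RHS]/(fun=> 0 : F) scaler0 addr0.
by exists 0 => // v; rewrite mul0r -[X in nr X]/(0 : F) nr0.
Qed.

Lemma boundedZ (a : R[i]) (x : F -> F) : bounded_op x -> bounded_op (a *: x).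
Proof. by move=> h; rewrite -[a *: x]addr0; apply: bounded_scaleD (bounded0). Qed.

Lemma boundedD (x y : F -> F) : bounded_op x -> bounded_op y -> bounded_op (x + y).
Proof. by move=> h; rewrite -[x]scale1r; apply: bounded_scaleD. Qed.

Lemma boundedB (x y : F -> F) : bounded_op x -> bounded_op y -> bounded_op (x - y).
Proof.
by move=> hx hy; rewrite addrC -scaleN1r; apply: bounded_scaleD.
Qed.

Lemma bounded_sum (I : Type) (s : seq I) (P : pred I) (f : I -> F -> F) :
  (forall i, P i -> bounded_op (f i)) -> bounded_op (\sum_(i <- s | P i) f i).
Proof. by move=> h; elim/big_ind: _ => //; [exact: bounded0|exact: boundedD]. Qed.

Lemma opbB (x y : F -> F) M N : opb x M -> opb y N -> opb (x - y) (M + N).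
Proof.
by move=> hx hy v; rewrite !fctE (le_trans (nrD _ _)) // nrN mulrDl lerD.
Qed.

Lemma opnorm_le (x : F -> F) (M : R) : 0 <= M -> opb x M -> opnorm x <= M.
Proof.
move=> M0 h; apply: ge_sup.
  by exists (nr (x 0)); exists 0 => //=; rewrite normr0 ler01.
move=> _ [v /= hv <-]; rewrite -/(nr _) (le_trans (h v)) //.
by rewrite ler_piMr // -lecR -normE.
Qed.

Lemma opnorm_opb (x : F -> F) : bounded_op x -> opb x (opnorm x).
Proof.
move=> /bounded_opP[lx [M M0 h]] v.
have [v0|v0] := eqVneq (nr v) 0.
  by rewrite (nr0_eq0 v0) (lin0 lx) nr0 mulr0.
have vp : 0 < nr v by rewrite lt_def v0 nr_ge0.
rewrite -ler_pdivrMr //; apply: ub_le_sup.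
  exists M => _ [w /= hw <-]; rewrite -/(nr _) (le_trans (h w)) //.
  by rewrite ler_piMr // -lecR -normE.
exists ((nr v)^-1%:C *: v).
  by rewrite /= normE nrZr ger0_norm ?invr_ge0 ?nr_ge0 // mulVf.
by rewrite -/(nr _) (linZ lx) nrZr ger0_norm ?invr_ge0 ?nr_ge0 // mulrC.
Qed.

Lemma opnorm_ge0 (x : F -> F) : bounded_op x -> 0 <= opnorm x.
Proof.
move=> /bounded_opP[lx [M M0 h]]; rewrite -[X in X <= _](nr0 F) -(lin0 lx).
apply: ub_le_sup; last by exists 0 => //=; rewrite normr0 ler01.
exists M => _ [w /= hw <-]; rewrite -/(nr _) (le_trans (h w)) //.
by rewrite ler_piMr // -lecR -normE.
Qed.

Lemma bounded_lim (u : nat -> F -> F) (x : F -> F) (M : R) : 0 <= M ->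
  (forall n, linear (u n)) -> (forall n, opb (u n) M) ->
  (forall v, u n v @[n --> \oo] --> x v) -> bounded_op x.
Proof.
move=> M0 lu hu hx; apply/bounded_opP; split; last first.
  by exists M => // v; apply: (cvg_le (cvg_nr (hx v))) => n; exact: hu.
move=> a v w; rewrite -[LHS](cvg_lim _ (hx _)) //; apply/cvg_lim => //.
under eq_fun do rewrite lu.
by apply: cvgD => //; exact: cvgZl_tmp.
Qed.

Lemma cvg_bounded (x : F -> F) (u : nat -> F) l : bounded_op x ->
  u n @[n --> \oo] --> l -> x (u n) @[n --> \oo] --> x l.
Proof.
move=> /bounded_opP[lx [M M0 h]] /cvg_nrP hu.
apply: (@cvg_nr_bound _ _ _ _ (fun n => nr (u n - l) * M)).
  by move=> n; rewrite -(linB lx) mulrC.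
exact: cvg0Mr.
Qed.

(** The representing vector is the minimizer of J u = |u|^2 - 2 g u, whose first-order condition is
    g h = [rd h z]. Working with real-linear g and [rd] makes this a problem about a real quadratic
    functional. *)
Lemma riesz (g : F -> R) (M : R) :
  (forall a u v, g (a%:C *: u + v) = a * g u + g v) ->
  (forall u, g u <= M * nr u) -> exists z, forall u, g u = rd u z.
Proof.
move=> lg bg.
have g0 : g 0 = 0.
  by have := lg 1 0 0; rewrite scaler0 addr0; lra.
have gZ a u : g (a%:C *: u) = a * g u by have := lg a u 0; rewrite addr0 g0 addr0.
have gD u v : g (u + v) = g u + g v.
  by have := lg 1 u v; rewrite scale1r mul1r.
have gN u : g (- u) = - g u by have := gD u (- u); rewrite subrr g0; lra.
pose J u := nr u ^+ 2 - 2 * g u.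
(* Completing the square: |u|^2 - 2 M |u| + M^2 = (|u| - M)^2. *)
have Jlb u : - M ^+ 2 <= J u.
  rewrite /J; have := bg u; have := sqr_ge0 (nr u - M); nra.
pose S := [set J u | u in [set: F]].
have hS : has_inf S.
  split; first by exists (J 0); exists 0.
  by exists (- M ^+ 2) => _ [u _ <-].
have Jinf u : inf S <= J u by apply: ge_inf; [case: hS | exists u].
(* Parallelogram law: |u - v|^2 = 2 J u + 2 J v - 4 J ((u + v) / 2), and J at the midpoint is at
   least the infimum. Minimizing sequences are thus Cauchy. *)
have Jmid u v : nr (u - v) ^+ 2 <= 2 * (J u - inf S) + 2 * (J v - inf S).
  have h := Jinf ((2^-1 : R)%:C *: (u + v)).
  move: h; rewrite /J -!(rdvv HF) !gZ gD !(rdZl, rdZr) !(rdDl, rdDr, rdNl, rdNr).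
  rewrite (rdC dF v u); lra.
have /choice[u hu] : forall n, exists u, J u < inf S + n.+1%:R^-1.
  move=> n.
  have e0 : 0 < n.+1%:R^-1 :> R by rewrite invr_gt0.
  have [_ [v _ <-] hv] := inf_adherent e0 hS.
  by exists v.
have inv0 : (n.+1%:R^-1 : R) @[n --> \oo] --> (0 : R).
  exact: (@cvg_harmonic R).
have : cvgn u.
  apply: cvg_nr_cauchy => e e0.
  have e4 : 0 < e ^+ 2 / 4 by rewrite divr_gt0 ?exprn_gt0.
  have /cvgrPdist_lt/(_ _ e4)[N _ hN] := inv0.
  exists N => m n hm hn.
  have h1 := hN _ hm; have h2 := hN _ hn; move: h1 h2.
  rewrite /= !sub0r !normrN !ger0_norm ?invr_ge0 // => h1 h2.
  have := Jmid (u m) (u n); have := hu m; have := hu n => h3 h4 h5.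
  have : nr (u m - u n) ^+ 2 < e ^+ 2.
    move: h1 h2 h3 h4 h5; clear.
    move: (J _) (J _) (inf S) (nr _ ^+ 2) (e ^+ 2) (m.+1%:R^-1) (n.+1%:R^-1).
    by move=> *; lra.
  by rewrite ltr_pXn2r // nnegrE ?nr_ge0 // ltW.
move=> /cvg_ex[z hz]; exists z => h.
have Jz : J z <= inf S.
  have hJ : J (u n) @[n --> \oo] --> J z.
    apply: cvgB.
      by rewrite expr2; under eq_fun do rewrite expr2; apply: cvgM; exact: cvg_nr.
    apply: cvgMl_tmp.
    have hb v : `|g v| <= nr v * M.
      by rewrite ler_norml mulrC bg lerNl -gN (le_trans (bg _)) // nrN.
    have /cvg_nrP/(@cvg0Mr _ _ M) := hz; apply: cvg_dist_bound => n.
    by rewrite -gN -gD hb.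
  have hI : inf S + n.+1%:R^-1 @[n --> \oo] --> inf S.
    by have := cvgD (cvg_cst (inf S)) inv0; rewrite addr0; apply.
  by apply: (ler_cvg_to hJ hI); apply: nearW => n; exact/ltW/hu.
(* J (z + t h) - J z is nonnegative and quadratic in t. Its value at the vertex t = - d / q is - d^2
   / q, which forces d = 0. *)
have key t : 0 <= 2 * t * (rd h z - g h) + t ^+ 2 * nr h ^+ 2.
  have := Jinf (z + t%:C *: h); move: Jz.
  rewrite /J -!(rdvv HF) gD gZ !(rdDl, rdDr, rdZl, rdZr) (rdC dF z h); nra.
have [h0|h0] := eqVneq (nr h) 0.
  by rewrite (nr0_eq0 h0) g0 rd0l.
have hp : 0 < nr h ^+ 2 by rewrite exprn_gt0 // lt_def h0 nr_ge0.
set d := rd h z - g h in key; set q := nr h ^+ 2 in key hp.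
have tq : - d / q * q = - d by rewrite divfK // gt_eqF.
have := key (- d / q); set t := - d / q in tq *; rewrite expr2 -(mulrA t) tq => hd.
have {}hd : 0 <= t * d * q.
  by rewrite mulr_ge0 ?(ltW hp) //; clearbody t d; lra.
have hd0 : d ^+ 2 <= 0 by move: hd; rewrite mulrAC tq mulNr -expr2 oppr_ge0.
 have : d == 0 by rewrite -sqrf_eq0 eq_le hd0 sqr_ge0.
by rewrite subr_eq0 => /eqP.
Qed.

(** Adjointness as a relation passes through sums, compositions and pointwise limits, whereas
    [adjoint] is a choice whose value is identified by exhibiting a candidate ([adjp_adjoint]). *)
Definition adjp (x y : F -> F) : Prop := forall u v, rd (x u) v = rd u (y v).

Lemma adjoint_ex (x : F -> F) : bounded_op x -> adjp x (adjoint dF x).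
Proof.
move=> /bounded_opP[lx [M M0 hx]] u v.
have [z hz] : exists z, forall u, rd (x u) v = rd u z.
  apply: (@riesz _ (M * nr v)).
    by move=> a w w'; rewrite lx rdDl rdZl.
  move=> w; apply: (le_trans (rd_le HF _ _)).
  by rewrite mulrAC ler_wpM2r ?nr_ge0.
(* The choice in [adjoint] needs the complex equation. The imaginary part of [dF u z] is [rd] at
   (-i) u and z, and x commutes with the scalar -i. *)
have hz' u' : dF (x u') v = dF u' z.
  rewrite !dF_rd hz; congr (_ +i* _).
  have e w w' : rd w ('i *: w') = rd ((- 'i) *: w) w'.
    rewrite rdZJ; congr (rd _ (_ *: _)).
    by rewrite rmorphN /=; congr (_ +i* _); rewrite ?opprK ?oppr0.
  by rewrite e -(linZ lx) hz -e.
have hg : forall u, dF (x u) v = dF u (adjoint dF x v).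
  by apply: (@xgetPex _ point [set z | forall u, dF (x u) v = dF u z]); exists z.
by rewrite /rd hg.
Qed.

Lemma adjp_uniq x y y' : adjp x y -> adjp x y' -> y = y'.
Proof.
move=> h h'; apply/funext => v; apply: (rd_eq HF) => w.
by rewrite rdC -h h' rdC.
Qed.

Lemma adjp_sym x y : adjp x y -> adjp y x.
Proof. by move=> h u v; rewrite rdC -h rdC. Qed.

Lemma adjp_adjoint x y : bounded_op x -> adjp x y -> adjoint dF x = y.
Proof. by move=> /adjoint_ex h1 h2; exact: adjp_uniq h1 h2. Qed.

Lemma adjp_comp x x' y y' : adjp x x' -> adjp y y' -> adjp (x \o y) (y' \o x').
Proof. by move=> h h' u v; rewrite /= h h'. Qed.

Lemma adjp_scaleD a x x' y y' : linear x ->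
  adjp x x' -> adjp y y' -> adjp (a *: x + y) (conjc a *: x' + y').
Proof.
move=> lx h h' u v; rewrite !fctE rdDl rdDr h' -(linZ lx) h.
by rewrite rdZJ.
Qed.

(** Test at u = y v: |y v|^2 = [rd (x (y v)) v] is at most M |y v| |v|. *)
Lemma adjp_opb x y M : 0 <= M -> opb x M -> adjp x y -> opb y M.
Proof.
move=> M0 hx h v.
have [v0|v0] := eqVneq (nr (y v)) 0; first by rewrite v0 mulr_ge0 ?nr_ge0.
have vp : 0 < nr (y v) by rewrite lt_def v0 nr_ge0.
rewrite -(ler_pM2l vp) -expr2 -(rdvv HF) -h (le_trans (rd_le HF _ _)) //.
by rewrite mulrA ler_wpM2r ?nr_ge0 // mulrC.
Qed.

Lemma adjp_bounded x y : bounded_op x -> adjp x y -> bounded_op y.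
Proof.
move=> /bounded_opP[lx [M M0 hx]] h; apply/bounded_opP; split; last first.
  by exists M => //; exact: adjp_opb h.
move=> a u v; apply: (rd_eq HF) => w.
rewrite rdC -h rdDr rdZrJ rdDl [in RHS]rdZJ; congr (_ + _).
  by rewrite -(linZ lx) h rdC.
by rewrite h rdC.
Qed.

Lemma adjp0 : adjp 0 0.
Proof. by move=> u v; exact: etrans (rd0l _ _) (esym (rd0r _ _)). Qed.

Lemma adjpZ a x x' : linear x -> adjp x x' -> adjp (a *: x) (conjc a *: x').
Proof.
move=> lx h; rewrite -[a *: x]addr0 -[conjc a *: x']addr0.
by apply: adjp_scaleD => //; exact: adjp0.
Qed.

Lemma adjpD x x' y y' : adjp x x' -> adjp y y' -> adjp (x + y) (x' + y').
Proof. by move=> h h' u v; rewrite !fctE rdDl rdDr h h'. Qed.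

Lemma adjpN x x' : adjp x x' -> adjp (- x) (- x').
Proof. by move=> h u v; rewrite !fctE rdNl rdNr h. Qed.

Lemma adjp_sum (I : Type) (r : seq I) (Q : pred I) (f g : I -> F -> F) :
  (forall i, Q i -> adjp (f i) (g i)) ->
  adjp (\sum_(i <- r | Q i) f i) (\sum_(i <- r | Q i) g i).
Proof.
move=> h; elim: r => [|i r IH]; first by rewrite !big_nil; exact: adjp0.
by rewrite !big_cons; case: ifP => // hi; apply: adjpD => //; exact: h.
Qed.

End BoundedOperators.

Lemma cvg_sumr (K : numFieldType) (V : normedModType K) (I : Type) (r : seq I)
    (Q : pred I) (f : I -> nat -> V) (a : I -> V) :
  (forall i, Q i -> f i n @[n --> \oo] --> a i) ->
  \sum_(i <- r | Q i) f i n @[n --> \oo] --> \sum_(i <- r | Q i) a i.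
Proof.
move=> h; elim: r => [|i r IH].
  by under eq_fun do rewrite big_nil; rewrite big_nil; exact: cvg_cst.
rewrite big_cons; under eq_fun do rewrite big_cons.
by case: ifP => // hi; apply: cvgD => //; exact: h.
Qed.

(** * Operator matrices on F^n: norm bounds and positivity *)

Section OperatorMatrices.
Variables (R : realType) (F : completeNormedModType R[i]).
Variables (dF : {dot F for Num.Def.conjC}) (HF : hilbert dF).
Local Notation rd := (rd dF).
Variable n : nat.
Implicit Types (X Y : 'I_n -> 'I_n -> F -> F) (u v : 'I_n -> F).

Definition sqn u : R := \sum_i nr (u i) ^+ 2.
Definition form X u v : R := \sum_i \sum_j rd (X i j (u j)) (v i).

(* By scaling [u] and [v] against each other, [wbound X M] says that the
   operator on F^n with matrix [X] has norm at most [M]. *)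
Definition wbound X (M : R) : Prop :=
  forall u v, 2 * form X u v <= M * (sqn u + sqn v).

Definition herm X : Prop := forall i j, adjp dF (X i j) (X j i).
(** [form] sees real parts only, so its nonnegativity does not entail self-adjointness
    (multiplication by i has form 0); the latter is demanded separately. *)
Definition psd X : Prop := herm X /\ forall u, 0 <= form X u u.

Lemma sqn_ge0 u : 0 <= sqn u.
Proof. by apply: sumr_ge0 => i _; rewrite sqr_ge0. Qed.

Lemma form_pair X u v : form X u v = \sum_p rd (X p.1 p.2 (u p.2)) (v p.1).
Proof. by rewrite /form pair_bigA. Qed.

Lemma form_app X u v : form X u v = \sum_i rd (\sum_j X i j (u j)) (v i).
Proof. by apply: eq_bigr => i _; rewrite rd_suml. Qed.

Lemma form_lim (Xs : nat -> 'I_n -> 'I_n -> F -> F) X u v :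
  (forall i j w, Xs m i j w @[m --> \oo] --> X i j w) ->
  form (Xs m) u v @[m --> \oo] --> form X u v.
Proof.
by move=> h; apply: cvg_sumr => i _; apply: cvg_sumr => j _; exact: cvg_rdl.
Qed.

Lemma wbound_lim (Xs : nat -> 'I_n -> 'I_n -> F -> F) X M :
  (forall i j w, Xs m i j w @[m --> \oo] --> X i j w) ->
  (forall m, wbound (Xs m) M) -> wbound X M.
Proof.
move=> h hM u v; apply: (@cvg_le _ (fun m => 2 * form (Xs m) u v)).
  by apply: cvgMl_tmp; exact: form_lim.
by move=> m; exact: hM.
Qed.

Lemma adjp_lim (xs ys : nat -> F -> F) x y :
  (forall w, xs m w @[m --> \oo] --> x w) -> (forall w, ys m w @[m --> \oo] --> y w) ->
  (forall m, adjp dF (xs m) (ys m)) -> adjp dF x y.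
Proof.
move=> hx hy h u v; have h1 := @cvg_rdl _ _ _ HF _ _ v (hx u).
have : rd (xs m u) v @[m --> \oo] --> rd u (y v).
  under eq_fun do rewrite h rdC; rewrite rdC; exact: cvg_rdl.
by move=> h2; rewrite -(cvg_lim _ h1) // (cvg_lim _ h2).
Qed.

Lemma psd_lim (Xs : nat -> 'I_n -> 'I_n -> F -> F) X :
  (forall i j w, Xs m i j w @[m --> \oo] --> X i j w) ->
  (forall m, psd (Xs m)) -> psd X.
Proof.
move=> h hX; split=> [i j|u].
  by apply: (adjp_lim (h i j) (h j i)) => m; case: (hX m).
rewrite -oppr_le0; apply: (@cvg_le _ (fun m => - form (Xs m) u u)).
  by apply: cvgN; exact: form_lim.
by move=> m; rewrite oppr_le0; case: (hX m).
Qed.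

Lemma wbound_le X M M' : wbound X M -> M <= M' -> wbound X M'.
Proof.
move=> h hM u v; apply: (le_trans (h u v)); rewrite ler_wpM2r //.
by rewrite addr_ge0 ?sqn_ge0.
Qed.

(** Forwards, test with v = t X u; the choice t = 1 / M gives the sharp bound. Backwards, 2 M [rd]
    (X u) v is at most |X u|^2 + M^2 |v|^2. Both divide by M, so M = 0 is treated apart. *)
Lemma wboundP X M : 0 <= M ->
  wbound X M <-> forall u, sqn (fun i => \sum_j X i j (u j)) <= M ^+ 2 * sqn u.
Proof.
move=> M0; split=> [h u|h u v].
  set Xu := fun i => _.
  have key t : 0 < t -> 2 * t * sqn Xu <= M * (sqn u + t ^+ 2 * sqn Xu).
    move=> t0; have := h u (fun i => t%:C *: Xu i); rewrite form_app.
    have -> : \sum_i rd (\sum_j X i j (u j)) (t%:C *: Xu i) = t * sqn Xu.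
      by rewrite mulr_sumr; apply: eq_bigr => i _; rewrite rdZr (rdvv HF).
    suff -> : sqn (fun i => t%:C *: Xu i) = t ^+ 2 * sqn Xu by rewrite mulrA.
    rewrite mulr_sumr; apply: eq_bigr => i _.
    by rewrite nrZr exprMn real_normK // num_real.
  have [M00|Mp] := eqVneq M 0.
    by have := key 1 ltr01; rewrite M00 expr0n /= !mul0r; lra.
  have {}Mp : 0 < M by rewrite lt_def Mp.
  have := key M^-1; rewrite invr_gt0 => /(_ Mp).
  rewrite mulrDr mulrA expr2 mulrA divff ?gt_eqF // mul1r.
  move=> {}h; have : M^-1 * sqn Xu <= M * sqn u by lra.
  by rewrite ler_pdivrMl // mulrA -expr2.
rewrite form_app.
have [M00|Mp] := eqVneq M 0.
  rewrite M00 mul0r.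
  have h0 i : \sum_j X i j (u j) = 0.
    have := h u; rewrite M00 expr0n /= mul0r => hu.
    apply/nr0_eq0/eqP; rewrite -sqrf_eq0; apply/eqP.
    have hs : sqn (fun i => \sum_j X i j (u j)) = 0.
      by apply/eqP; rewrite eq_le hu sqn_ge0.
    have /psumr_eq0P hh := hs; apply: hh => // k _; exact: sqr_ge0.
  by under eq_bigr do rewrite h0 rd0l; rewrite big1 ?mulr0.
have {}Mp : 0 < M by rewrite lt_def Mp.
set Xu := fun i => \sum_j X i j (u j) in h *.
have key i : 2 * M * rd (Xu i) (v i) <= nr (Xu i) ^+ 2 + M ^+ 2 * nr (v i) ^+ 2.
  have := sqr_ge0 (nr (Xu i - M%:C *: v i)).
  by rewrite -!(rdvv HF) !(rdBl, rdBr, rdZl, rdZr) (rdC dF (v i)); lra.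
have : 2 * M * \sum_i rd (Xu i) (v i) <= sqn Xu + M ^+ 2 * sqn v.
  rewrite !mulr_sumr -big_split /=; apply: ler_sum => i _; exact: key.
have := h u; rewrite -/Xu; move: (sqn Xu) (sqn u) (sqn v) (\sum_i _) => a b c d h1 h2.
by rewrite -(ler_pM2l Mp); nra.
Qed.

Lemma wbound_comp X Y M N : (forall i j, linear (X i j)) -> 0 <= M -> 0 <= N ->
  wbound X M -> wbound Y N ->
  wbound (fun i j => \sum_k (X i k \o Y k j)) (M * N).
Proof.
move=> lX M0 N0 /(wboundP _ M0) hX /(wboundP _ N0) hY.
apply/wboundP; first exact: mulr_ge0.
move=> u; rewrite exprMn -mulrA.
apply: le_trans (ler_wpM2l (sqr_ge0 M) (hY u)).
apply: le_trans (hX _); rewrite le_eqVlt; apply/orP; left; apply/eqP.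
congr (sqn _); apply/funext => i.
under eq_bigr do rewrite fct_sumE.
by rewrite exchange_big; apply: eq_bigr => k _; rewrite (lin_sum (lX i k)).
Qed.

Lemma formDl X Y u v : form (fun i j => X i j + Y i j) u v = form X u v + form Y u v.
Proof.
rewrite -big_split /=; apply: eq_bigr => i _; rewrite -big_split /=.
by apply: eq_bigr => j _; rewrite -rdDl.
Qed.

Lemma formZl (a : R) X u v : form (fun i j => a%:C *: X i j) u v = a * form X u v.
Proof.
rewrite mulr_sumr; apply: eq_bigr => i _; rewrite mulr_sumr.
by apply: eq_bigr => j _; rewrite -rdZl.
Qed.

Lemma wboundD X Y M N : wbound X M -> wbound Y N ->
  wbound (fun i j => X i j + Y i j) (M + N).
Proof. by move=> hX hY u v; rewrite formDl [2 * _]mulrDr [(M + N) * _]mulrDl lerD. Qed.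

Lemma wboundZ (a : R) X M : 0 <= a -> wbound X M ->
  wbound (fun i j => a%:C *: X i j) (a * M).
Proof. by move=> a0 hX u v; rewrite formZl mulrCA -mulrA ler_wpM2l. Qed.

(* Polarization: [0 <= form Y (u - v) (u - v)]. *)
Lemma psd_wbound Y M : (forall i j, linear (Y i j)) -> psd Y ->
  (forall u, form Y u u <= M * sqn u) -> wbound Y M.
Proof.
move=> lY [hY pY] hM u v; have := pY (fun i => u i - v i).
have -> : form Y (fun i => u i - v i) (fun i => u i - v i) =
    form Y u u - form Y u v - (form Y v u - form Y v v).
  rewrite /form -!sumrB; apply: eq_bigr => i _; rewrite -!sumrB.
  by apply: eq_bigr => j _; rewrite (linB (lY i j)) !(rdBl, rdBr); lra.
have -> : form Y v u = form Y u v.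
  rewrite /form exchange_big; apply: eq_bigr => i _; apply: eq_bigr => j _.
  by rewrite hY rdC.
by have := hM u; have := hM v; lra.
Qed.

Lemma sqn1 (i : 'I_n) u : (forall j, j != i -> u j = 0) -> sqn u = nr (u i) ^+ 2.
Proof.
by move=> h; rewrite /sqn (bigD1 i) //= big1 ?addr0 // => j ij; rewrite h // nr0 expr0n.
Qed.

Lemma wbound_entry X M : 0 <= M -> (forall i j, linear (X i j)) -> wbound X M ->
  forall i j, opb (X i j) M.
Proof.
move=> M0 lX /(wboundP _ M0) h i j w.
(* A vector supported at j isolates column j, and the squared norm of that column dominates each of
   its entries. *)
pose u k := if k == j then w else 0.
have e k : \sum_l X k l (u l) = X k j w.
  rewrite (bigD1 j) //= {1}/u eqxx big1 ?addr0 // => l lj.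
  by rewrite /u (negPf lj) (lin0 (lX k l)).
have su : sqn u = nr w ^+ 2.
  by rewrite (@sqn1 j) /u ?eqxx // => k /negPf->.
rewrite -(@ler_pXn2r _ 2) ?nnegrE ?mulr_ge0 ?nr_ge0 // exprMn -su.
apply: le_trans (h u); rewrite /sqn (bigD1 i) //= e lerDl.
by apply: sumr_ge0 => k _; exact: sqr_ge0.
Qed.

Lemma form_le X (M : R) : (forall i j, opb (X i j) M) -> 0 <= M ->
  exists2 K, 0 <= K & forall u, form X u u <= K * sqn u.
Proof.
move=> hX M0; exists (M * n%:R); first by rewrite mulr_ge0.
move=> u; apply: (@le_trans _ _ (\sum_(i < n) \sum_(j < n)
    M * ((nr (u i) ^+ 2 + nr (u j) ^+ 2) / 2))).
  apply: ler_sum => i _; apply: ler_sum => j _.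
  apply: (le_trans (rd_le HF _ _)).
  apply: (@le_trans _ _ (M * nr (u j) * nr (u i))).
    by rewrite ler_wpM2r ?nr_ge0 //; exact: hX.
  rewrite -mulrA ler_wpM2l //; have := sqr_ge0 (nr (u i) - nr (u j)); nra.
rewrite le_eqVlt; apply/orP; left; apply/eqP.
under eq_bigr do rewrite -mulr_sumr -mulr_suml.
rewrite -mulr_sumr -mulr_suml -mulrA; congr (_ * _).
have -> : \sum_(i < n) \sum_(j < n) (nr (u i) ^+ 2 + nr (u j) ^+ 2) = (n%:R * sqn u) *+ 2.
  under eq_bigr do rewrite big_split /= sumr_const card_ord -mulr_natl.
  rewrite big_split /= sumr_const card_ord mulr2n; congr (_ + _).
    by rewrite mulr_sumr.
  by rewrite mulr_natl.
by rewrite -mulr_natr mulfK.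
Qed.

Lemma psdD X Y : psd X -> psd Y -> psd (fun i j => X i j + Y i j).
Proof.
move=> [hX pX] [hY pY]; split=> [i j u v|u].
  by rewrite !fctE rdDl rdDr hX hY.
by rewrite formDl addr_ge0.
Qed.

Lemma psdZ (a : R) X : 0 <= a -> psd X -> psd (fun i j => a%:C *: X i j).
Proof.
move=> a0 [hX pX]; split=> [i j u v|u].
  by rewrite !fctE rdZl rdZr hX.
by rewrite formZl mulr_ge0.
Qed.

Lemma psd_sum (I : Type) (r : seq I) (Q : pred I) (Xs : I -> 'I_n -> 'I_n -> F -> F) :
  (forall k, Q k -> psd (Xs k)) -> psd (fun i j => \sum_(k <- r | Q k) Xs k i j).
Proof.
move=> h; elim: r => [|k r IH].
  under eq_fun do under eq_fun do rewrite big_nil.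
  split=> [i j u v|u].
    exact: etrans (rd0l _ _) (esym (rd0r _ _)).
  rewrite /form; apply: sumr_ge0 => i _; apply: sumr_ge0 => j _.
  by rewrite le_eqVlt; apply/orP; left; apply/eqP/esym; exact: rd0l.
under eq_fun do under eq_fun do rewrite big_cons.
case hk: (Q k) => //.
by apply: psdD => //; exact: h.
Qed.

End OperatorMatrices.

(** * Convergence, continuity and positivity of [P_omega] *)

Section WeightedConjugation.
Variables (R : realType) (F : completeNormedModType R[i]).
Variables (dF : {dot F for Num.Def.conjC}) (HF : hilbert dF).
Local Notation rd := (rd dF).
Variables (Theta : set nat) (omega : nat -> R) (l : nat -> F -> F).
Hypothesis omega_gt0 : forall i, Theta i -> 0 < omega i.
Hypothesis omega_sum :
  \sum_(i < n | (i : nat) \in Theta) omega i @[n --> \oo] --> (1 : R).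
Hypothesis l_bounded : forall i, Theta i -> bounded_op (l i).
Hypothesis l_isometry : forall i, Theta i -> forall u v, rd (l i u) (l i v) = rd u v.

Local Notation P := (P_omega dF Theta omega l).

Let W n : R := \sum_(i < n | (i : nat) \in Theta) omega i.
Let Pn (x : F -> F) n (v : F) : F :=
  \sum_(i < n | (i : nat) \in Theta) (omega i)%:C *: adjoint dF (l i) (x (l i v)).

Let W_S n : W n.+1 = W n + (if n \in Theta then omega n else 0).
Proof. by rewrite /W big_mkcond big_ord_recr /= -big_mkcond. Qed.

Let Pn_S x n v : Pn x n.+1 v = Pn x n v +
  (if n \in Theta then (omega n)%:C *: adjoint dF (l n) (x (l n v)) else 0).
Proof. by rewrite /Pn big_mkcond big_ord_recr /= -big_mkcond. Qed.

Let W_le m n : (m <= n)%N -> W m <= W n.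
Proof.
move=> mn; rewrite -(subnK mn); elim: (n - m)%N => // k IH.
rewrite addSn W_S (le_trans IH) // lerDl.
by case: ifPn => // /set_mem /omega_gt0 /ltW.
Qed.

Let W_le1 n : W n <= 1.
Proof.
apply: (ler_cvg_to (cvg_cst (W n)) omega_sum).
by exists n => // m; exact: W_le.
Qed.

Let W_to1 : (1 - W n) @[n --> \oo] --> (0 : R).
Proof. by rewrite -[X in _ --> X](subrr 1); apply: cvgB => //; exact: cvg_cst. Qed.

Lemma isometry_nr i v : Theta i -> nr (l i v) = nr v.
Proof.
move=> hi; apply/eqP; rewrite -(@eqrXn2 _ 2) ?nr_ge0 //.
by rewrite -!(rdvv HF) l_isometry.
Qed.

Let l_adjp i : Theta i -> adjp dF (l i) (adjoint dF (l i)).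
Proof. by move=> hi; exact: adjoint_ex (l_bounded hi). Qed.

Let ladj_bounded i : Theta i -> bounded_op (adjoint dF (l i)).
Proof. by move=> hi; exact: adjp_bounded (l_bounded hi) (l_adjp hi). Qed.

Let ladj_le i v : Theta i -> nr (adjoint dF (l i) v) <= nr v.
Proof.
move=> hi; have := @adjp_opb _ _ _ HF (l i) _ 1 _ _ (l_adjp hi) v.
by rewrite mul1r; apply => // w; rewrite isometry_nr ?mul1r.
Qed.

(** The i-th summand has norm at most omega_i M |v|, since l_i is isometric and its adjoint
    contractive. Tails of the operator series are thus controlled by tails of the weights, uniformly
    over all x with bound M. *)
Let Pn_dist x M n m v : opb x M -> (n <= m)%N ->
  nr (Pn x m v - Pn x n v) <= (W m - W n) * (M * nr v).
Proof.
move=> hx nm; rewrite -(subnK nm); elim: (m - n)%N => [|k IH].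
  by rewrite add0n !subrr nr0 mul0r.
rewrite addSn Pn_S W_S addrAC (addrAC (W _)) mulrDl (le_trans (nrD _ _)) // lerD //.
case: ifPn => [/set_mem hi|_]; last by rewrite nr0 mul0r.
rewrite nrZr gtr0_norm ?omega_gt0 // ler_wpM2l //; first exact/ltW/omega_gt0.
by rewrite (le_trans (ladj_le _ hi)) // (le_trans (hx _)) // isometry_nr.
Qed.

Let Pn_cvgn x v : bounded_op x -> cvgn (Pn x ^~ v).
Proof.
move=> /bounded_opP[lx [M M0 hx]]; apply: cvg_nr_cauchy => e e0.
have /cvgrPdist_lt/(_ _ e0)[N _ hN] := cvg0Mr (2 * (M * nr v)) W_to1.
exists N => m n hm hn.
have K0 : 0 <= M * nr v by rewrite mulr_ge0 ?nr_ge0.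
have := hN _ (leqnn N); rewrite /= sub0r normrN ger0_norm; last first.
  by rewrite mulr_ge0 ?subr_ge0 // mulr_ge0.
apply: le_lt_trans.
rewrite -(subrK (Pn x N v) (Pn x m v)) -addrA (le_trans (nrD _ _)) // [X in _ + X]nrC.
have h1 := Pn_dist v hx hm; have h2 := Pn_dist v hx hn.
have h3 : (W m - W N) * (M * nr v) <= (1 - W N) * (M * nr v).
  by rewrite ler_wpM2r // lerD2r.
have h4 : (W n - W N) * (M * nr v) <= (1 - W N) * (M * nr v).
  by rewrite ler_wpM2r // lerD2r.
by lra.
Qed.

Let P_cvg x v : bounded_op x -> Pn x n v @[n --> \oo] --> P x v.
Proof. by move=> hx; exact: Pn_cvgn. Qed.

Let P_dist x M n v : bounded_op x -> 0 <= M -> opb x M ->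
  nr (P x v - Pn x n v) <= (1 - W n) * (M * nr v).
Proof.
move=> bx M0 hx; have h : nr (Pn x m v - Pn x n v) @[m --> \oo] --> nr (P x v - Pn x n v).
  by apply: cvg_nr; apply: cvgB; [exact: P_cvg|exact: cvg_cst].
apply: (ler_cvg_to h (cvg_cst _)); exists n => // m /= nm.
apply: (le_trans (Pn_dist v hx nm)); rewrite ler_wpM2r ?mulr_ge0 ?nr_ge0 //.
by rewrite lerD2r.
Qed.

Let Pn_lin x n : linear x -> linear (Pn x n).
Proof.
move=> lx a u v; rewrite /Pn scaler_sumr -big_split /=; apply: eq_bigr => i /set_mem hi.
rewrite (bounded_lin (l_bounded hi)) lx (bounded_lin (ladj_bounded hi)).
by rewrite scalerDr !scalerA mulrC.
Qed.

Lemma P_opb x M : bounded_op x -> 0 <= M -> opb x M -> opb (P x) M.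
Proof.
(* At n = 0 the partial sum is empty and [W 0] = 0, so the truncation error is P x v itself. *)
move=> bx M0 hx v; have := P_dist 0 v bx M0 hx.
by rewrite /Pn /W !big_ord0 !subr0 mul1r.
Qed.

Lemma P_bounded x : bounded_op x -> bounded_op (P x).
Proof.
move=> bx; have /bounded_opP[lx [M M0 hx]] := bx; apply/bounded_opP; split.
  move=> a u v; rewrite -[LHS](cvg_lim _ (P_cvg bx)) //; apply/cvg_lim => //.
  under eq_fun => n do rewrite (Pn_lin n lx).
  by apply: cvgD; [apply: cvgZl_tmp|]; exact: P_cvg.
by exists M => //; exact: P_opb.
Qed.

Lemma P_scaleD a x y : bounded_op x -> bounded_op y ->
  P (a *: x + y) = a *: P x + P y.
Proof.
move=> bx bY; apply/funext => v; rewrite !fctE.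
apply: (@cvg_lim _ _ _ _ _ (Pn (a *: x + y) ^~ v)) => //.
have -> : (Pn (a *: x + y) ^~ v) = fun n => a *: Pn x n v + Pn y n v.
  apply/funext => n; rewrite /Pn scaler_sumr -big_split /=.
  apply: eq_bigr => i /set_mem hi; rewrite !fctE (bounded_lin (ladj_bounded hi)).
  by rewrite scalerDr !scalerA mulrC.
by apply: cvgD; [apply: cvgZl_tmp|]; exact: P_cvg.
Qed.

Lemma P_rd x u v : bounded_op x ->
  \sum_(i < n | (i : nat) \in Theta) omega i * rd (x (l i u)) (l i v)
    @[n --> \oo] --> rd (P x u) v.
Proof.
move=> bx; have := @cvg_rdl _ _ _ HF _ _ v (P_cvg (v := u) bx); apply: cvg_trans.
apply: near_eq_cvg; apply: nearW => n; rewrite /Pn rd_suml; apply: eq_bigr => i /set_mem hi.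
by rewrite rdZl rdC -l_adjp // rdC.
Qed.

(** An upper bound that holds after conjugation by every l_i survives averaging with positive
    weights of sum 1. Finite families are allowed so that norm bounds, positivity and adjoints of
    matrices all become instances. *)
Lemma P_form_le (K : finType) (x : K -> F -> F) (u v : K -> F) c :
  (forall k, bounded_op (x k)) ->
  (forall i, Theta i -> \sum_k rd (x k (l i (u k))) (l i (v k)) <= c) ->
  \sum_k rd (P (x k) (u k)) (v k) <= c.
Proof.
move=> bx h.
have h1 : \sum_k \sum_(i < n | (i : nat) \in Theta)
    omega i * rd (x k (l i (u k))) (l i (v k)) @[n --> \oo] -->
    \sum_k rd (P (x k) (u k)) (v k).
  by apply: cvg_sumr => k _; exact: P_rd.
have h2 : W n * c @[n --> \oo] --> c.
  by rewrite -[X in _ --> X]mul1r; exact: cvgMr_tmp.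
apply: (ler_cvg_to h1 h2); apply: nearW => n; rewrite exchange_big /= mulr_suml.
apply: ler_sum => i /set_mem hi; rewrite -mulr_sumr ler_wpM2l //; first exact/ltW/omega_gt0.
exact: h.
Qed.

Lemma P_id : P id = id.
Proof.
apply/funext => u; apply: (rd_eq HF) => v.
have h := @P_rd id u v (bounded_id F); rewrite -[LHS](cvg_lim _ h) //.
apply/cvg_lim => //; rewrite -[X in _ --> X]mul1r.
have : W n * rd u v @[n --> \oo] --> 1 * rd u v by exact: cvgMr_tmp.
apply: cvg_trans; apply: near_eq_cvg; apply: nearW => n.
by rewrite mulr_suml; apply: eq_bigr => i /set_mem hi; rewrite l_isometry.
Qed.

(** Since [M] does not depend on m, all the series can be cut at the same n, the two truncation
    errors together staying below e / 2. What remains is a finite sum, which converges termwise. *)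
Lemma P_normal (x : nat -> F -> F) (y : F -> F) (M : R) u : 0 <= M ->
  (forall m, bounded_op (x m)) -> (forall m, opb (x m) M) ->
  (forall v, x m v @[m --> \oo] --> y v) -> P (x m) u @[m --> \oo] --> P y u.
Proof.
move=> M0 bx hx hy.
have bY : bounded_op y.
  by apply: (bounded_lim M0 _ hx hy) => m; exact/bounded_lin.
have hY : opb y M by move=> v; apply: (cvg_le (cvg_nr (hy v))) => m; exact: hx.
apply/cvg_nrP/cvgrPdist_lt => e e0; have e2 : 0 < e / 2 by rewrite divr_gt0.
have /cvgrPdist_lt/(_ _ e2)[n _ /(_ n (leqnn n))] := cvg0Mr (2 * (M * nr u)) W_to1.
rewrite /= sub0r normrN ger0_norm; last first.
  by rewrite mulr_ge0 ?mulr_ge0 ?nr_ge0 // subr_ge0.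
move=> hn.
have : Pn (x m) n u @[m --> \oo] --> Pn y n u.
  apply: cvg_sumr => i /set_mem hi; apply: cvgZl_tmp.
  by apply: cvg_bounded (ladj_bounded hi) _; exact: hy.
move=> /cvg_nrP/cvgrPdist_lt/(_ _ e2); apply: filterS => m.
rewrite !sub0r !normrN !ger0_norm ?nr_ge0 // => hm.
have h1 := P_dist n u (bx m) M0 (hx m); have h2 := P_dist n u bY M0 hY.
have -> : P (x m) u - P y u = (P (x m) u - Pn (x m) n u) +
    ((Pn (x m) n u - Pn y n u) - (P y u - Pn y n u)).
  by rewrite opprB !subrKA.
have := nrD (P (x m) u - Pn (x m) n u) ((Pn (x m) n u - Pn y n u) - (P y u - Pn y n u)).
have := nrD (Pn (x m) n u - Pn y n u) (- (P y u - Pn y n u)).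
by rewrite nrN; lra.
Qed.

Lemma P_adjp x y : bounded_op x -> bounded_op y -> adjp dF x y -> adjp dF (P x) (P y).
Proof.
suff h x' y' : bounded_op x' -> bounded_op y' -> adjp dF x' y' ->
    forall u v, rd (P x' u) v <= rd (P y' v) u.
  move=> bx bY hxy u v; apply/eqP; rewrite eq_le [rd u _]rdC h //=.
  by apply: h => //; exact: adjp_sym.
move=> bx bY hxy u v; rewrite -subr_le0 -rdNr.
(* A family of two forms, at (u, v) and (v, - u), whose conjugated values cancel; the bound 0 is
   then one of the two inequalities, and exchanging the roles of x and y gives the other. *)
have := @P_form_le bool (fun b => if b then x' else y')
  (fun b => if b then u else v) (fun b => if b then v else - u) 0.
rewrite !big_bool /=; apply; first by case.
move=> i hi; rewrite big_bool /= (linN (bounded_lin (l_bounded hi))) rdNr.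
by rewrite hxy rdC subrr.
Qed.

Let sqn_l n (u : 'I_n -> F) i : Theta i -> sqn (fun k => l i (u k)) = sqn u.
Proof. by move=> hi; apply: eq_bigr => k _; rewrite isometry_nr. Qed.

Lemma P_wbound n (X : 'I_n -> 'I_n -> F -> F) M : (forall i j, bounded_op (X i j)) ->
  wbound dF X M -> wbound dF (fun i j => P (X i j)) M.
Proof.
move=> bX h u v; rewrite -ler_pdivlMl // form_pair.
apply: (@P_form_le _ (fun p => X p.1 p.2) (fun p => u p.2) (fun p => v p.1)) => //= i hi.
rewrite ler_pdivlMl // -(@sqn_l _ u _ hi) -(@sqn_l _ v _ hi).
by have := h (fun k => l i (u k)) (fun k => l i (v k)); rewrite form_pair.
Qed.

Lemma P_psd n (X : 'I_n -> 'I_n -> F -> F) : (forall i j, bounded_op (X i j)) ->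
  psd dF X -> psd dF (fun i j => P (X i j)).
Proof.
move=> bX [hX pX]; split=> [i j|u]; first exact: P_adjp.
(* [P_form_le] yields upper bounds, so the sign is moved into the second argument of the form. *)
rewrite form_pair -oppr_le0 -sumrN; under eq_bigr do rewrite -rdNr.
apply: (@P_form_le _ (fun p => X p.1 p.2) (fun p => u p.2) (fun p => - u p.1)) => //= i hi.
under eq_bigr do rewrite (linN (bounded_lin (l_bounded hi))) rdNr.
by rewrite sumrN oppr_le0 -(form_pair dF X (fun k => l i (u k)) (fun k => l i (u k))).
Qed.

End WeightedConjugation.

(** * Eigenspaces and the peripheral boundary of an abstract unital completely positive P *)

Section PeripheralBoundary.
Variables (R : realType) (F : completeNormedModType R[i]).
Variables (dF : {dot F for Num.Def.conjC}) (HF : hilbert dF).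
Local Notation rd := (rd dF).
Variable P : (F -> F) -> F -> F.
Hypothesis P_bounded : forall x, bounded_op x -> bounded_op (P x).
Hypothesis P_opb : forall x M, bounded_op x -> 0 <= M -> opb x M -> opb (P x) M.
Hypothesis P_scaleD : forall a x y, bounded_op x -> bounded_op y ->
  P (a *: x + y) = a *: P x + P y.
Hypothesis P_id : P id = id.
Hypothesis P_normal : forall (x : nat -> F -> F) (y : F -> F) (M : R) u, 0 <= M ->
  (forall m, bounded_op (x m)) -> (forall m, opb (x m) M) ->
  (forall v, x m v @[m --> \oo] --> y v) -> P (x m) u @[m --> \oo] --> P y u.
Hypothesis P_adjp : forall x y, bounded_op x -> bounded_op y ->
  adjp dF x y -> adjp dF (P x) (P y).
Hypothesis P_wbound : forall n (X : 'I_n -> 'I_n -> F -> F) M,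
  (forall i j, bounded_op (X i j)) ->
  wbound dF X M -> wbound dF (fun i j => P (X i j)) M.
Hypothesis P_psd : forall n (X : 'I_n -> 'I_n -> F -> F),
  (forall i j, bounded_op (X i j)) ->
  psd dF X -> psd dF (fun i j => P (X i j)).

Local Notation B := (peripheral_boundary P).
Local Notation eig := (Defs.eigenspace P).
Local Notation span := (lspan [set z | exists2 lambda : R[i], `|lambda| = 1 & eig lambda z]).

Lemma iter_bounded m x : bounded_op x -> bounded_op (iter m P x).
Proof. by move=> bx; elim: m => //= m; exact: P_bounded. Qed.

Lemma iter_opb m x M : bounded_op x -> 0 <= M -> opb x M -> opb (iter m P x) M.
Proof. by move=> bx M0 hx; elim: m => //= m; apply: P_opb => //; exact: iter_bounded. Qed.

Lemma iter_scaleD m a x y : bounded_op x -> bounded_op y ->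
  iter m P (a *: x + y) = a *: iter m P x + iter m P y.
Proof. by move=> bx bY; elim: m => //= m ->; apply: P_scaleD; exact: iter_bounded. Qed.

Lemma iter0 m : iter m P 0 = 0.
Proof.
have b0 := bounded0 F; have := iter_scaleD m 1 b0 b0.
by rewrite !scale1r addr0 => /eqP; rewrite -subr_eq subrr eq_sym => /eqP.
Qed.

Lemma iterZ m a x : bounded_op x -> iter m P (a *: x) = a *: iter m P x.
Proof.
by move=> bx; rewrite -[a *: x]addr0 iter_scaleD ?iter0 ?addr0 //; exact: bounded0.
Qed.

Lemma iter_sum m (I : Type) (r : seq I) (Q : pred I) (f : I -> F -> F) :
  (forall i, bounded_op (f i)) ->
  iter m P (\sum_(i <- r | Q i) f i) = \sum_(i <- r | Q i) iter m P (f i).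
Proof.
move=> hf; elim: r => [|i r IH]; first by rewrite !big_nil iter0.
rewrite !big_cons; case: ifP => // _.
by rewrite -[f i]scale1r iter_scaleD ?scale1r ?IH //; exact: bounded_sum.
Qed.

Lemma P0 : P 0 = 0.
Proof. exact: iter0 1. Qed.

Lemma PZ a x : bounded_op x -> P (a *: x) = a *: P x.
Proof. exact: iterZ 1 a x. Qed.

Lemma P_sum (I : Type) (r : seq I) (Q : pred I) (f : I -> F -> F) :
  (forall i, bounded_op (f i)) ->
  P (\sum_(i <- r | Q i) f i) = \sum_(i <- r | Q i) P (f i).
Proof. exact: iter_sum 1 I r Q f. Qed.

Lemma iter_adjp m x y : bounded_op x -> bounded_op y ->
  adjp dF x y -> adjp dF (iter m P x) (iter m P y).
Proof.
by move=> bx bY h; elim: m => //= m; apply: P_adjp; exact: iter_bounded.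
Qed.

Lemma iter_wbound m n (X : 'I_n -> 'I_n -> F -> F) M : (forall i j, bounded_op (X i j)) ->
  wbound dF X M -> wbound dF (fun i j => iter m P (X i j)) M.
Proof.
by move=> bX h; elim: m => //= m; apply: P_wbound => i j; exact: iter_bounded.
Qed.

Lemma iter_psd m n (X : 'I_n -> 'I_n -> F -> F) : (forall i j, bounded_op (X i j)) ->
  psd dF X -> psd dF (fun i j => iter m P (X i j)).
Proof.
by move=> bX h; elim: m => //= m; apply: P_psd => i j; exact: iter_bounded.
Qed.

Lemma iter_eig m a x : eig a x -> iter m P x = a ^+ m *: x.
Proof.
move=> [bx hx]; elim: m => [|m IH]; first by rewrite expr0 scale1r.
by rewrite iterS IH PZ // hx scalerA exprSr.
Qed.

Lemma iter_fixed m x : eig 1 x -> iter m P x = x.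
Proof. by move=> /(iter_eig m) ->; rewrite expr1n scale1r. Qed.

Lemma eig_id : eig 1 id.
Proof. by split; [exact: bounded_id|rewrite P_id scale1r]. Qed.

Lemma eig_scaleD a b x y : eig a x -> eig a y -> eig a (b *: x + y).
Proof.
move=> [bx hx] [bY hY]; split; first exact: bounded_scaleD.
by rewrite P_scaleD // hx hY scalerDr !scalerA mulrC.
Qed.

Lemma eig0 a : eig a 0.
Proof. by split; [exact: bounded0|rewrite P0 scaler0]. Qed.

Lemma eigZ a b x : eig a x -> eig a (b *: x).
Proof. by move=> hx; rewrite -[b *: x]addr0; apply: eig_scaleD => //; exact: eig0. Qed.

Lemma eigD a x y : eig a x -> eig a y -> eig a (x + y).
Proof. by move=> hx; rewrite -[x]scale1r; exact: eig_scaleD. Qed.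

Lemma eig_sum a (I : Type) (r : seq I) (Q : pred I) (f : I -> F -> F) :
  (forall i, Q i -> eig a (f i)) -> eig a (\sum_(i <- r | Q i) f i).
Proof. by move=> h; elim/big_ind: _ => //; [exact: eig0|exact: eigD]. Qed.

(** Coefficients are absorbed into the eigenvectors; the eigenvalues, which may repeat, become
    explicit data. *)
Lemma spanP y : span y <-> exists n (lam : 'I_n -> R[i]) (x : 'I_n -> F -> F),
  (forall k, `|lam k| = 1 /\ eig (lam k) (x k)) /\ y = \sum_k x k.
Proof.
split=> [[n [c [x [hx ->]]]]|[n [lam [x [hx ->]]]]].
  have /choice[lam hlam] : forall k, exists lam : R[i], `|lam| = 1 /\ eig lam (x k).
    by move=> k; have [lam h1 h2] := hx k; exists lam.
  exists n, lam, (fun k => c k *: x k); split=> // k; have [h1 h2] := hlam k.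
  by split=> //; exact: eigZ.
exists n, (fun=> 1), x; split; last by apply: eq_bigr => k _; rewrite scale1r.
by move=> k; have [h1 h2] := hx k; exists (lam k).
Qed.

Lemma span_bounded y : span y -> bounded_op y.
Proof.
by move=> /spanP[n [lam [x [hx ->]]]]; apply: bounded_sum => k _; case: (hx k) => _ [].
Qed.

Lemma span_scaleD a x y : span x -> span y -> span (a *: x + y).
Proof.
move=> /spanP[n [lam [f [hf ->]]]] /spanP[m [mu [g [hg ->]]]]; apply/spanP.
exists (n + m)%N, (fun k => match fintype.split k with inl i => lam i | inr j => mu j end).
exists (fun k => match fintype.split k with inl i => a *: f i | inr j => g j end).
split=> [k|].
  case: fintype.split => i; first by have [h1 h2] := hf i; split=> //; exact: eigZ.
  exact: hg.
rewrite big_split_ord /= scaler_sumr; congr (_ + _); apply: eq_bigr => i _.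
  by rewrite -[lshift m i]/(unsplit (inl i)) unsplitK.
by rewrite -[rshift n i]/(unsplit (inr i)) unsplitK.
Qed.

Lemma eig_span a x : `|a| = 1 -> eig a x -> span x.
Proof.
move=> ha hx; apply/spanP; exists 1%N, (fun=> a), (fun=> x); split=> //.
by rewrite big_ord1.
Qed.

Lemma periph_bounded x : B x -> bounded_op x.
Proof. by case. Qed.

Lemma periph_approx x eps : B x -> 0 < eps -> exists2 y, span y & opb (x - y) eps.
Proof.
move=> [bx h] /h[y hy hxy]; exists y => //.
apply: opb_le (ltW hxy); apply: opnorm_opb; apply: boundedB => //.
exact: span_bounded.
Qed.

Lemma periph_of_approx x : bounded_op x ->
  (forall eps, 0 < eps -> exists2 y, span y & opb (x - y) eps) -> B x.
Proof.
move=> bx h; split=> // eps e0; have e2 : 0 < eps / 2 by rewrite divr_gt0.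
have [y hy hxy] := h _ e2; exists y => //.
by apply: le_lt_trans (opnorm_le (ltW e2) hxy) _; lra.
Qed.

Lemma span_periph x : span x -> B x.
Proof.
move=> hx; apply: periph_of_approx; first exact: span_bounded.
move=> eps e0; exists x => // v; rewrite subrr -[X in nr X]/(0 : F) nr0.
by rewrite mulr_ge0 ?nr_ge0 // ltW.
Qed.

Lemma periph_scaleD a x y : B x -> B y -> B (a *: x + y).
Proof.
move=> hx hy; apply: periph_of_approx.
  by apply: bounded_scaleD; exact: periph_bounded.
move=> eps e0; set c := complex.Re `|a|.
have c0 : 0 <= c by rewrite -ler0c RRe_real ?normr_real.
(* The summand 1 keeps the denominator positive when a = 0. *)
have e1 : 0 < eps / (2 * (c + 1)) by rewrite divr_gt0 // mulr_gt0 // ltr_wpDl.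
have e2 : 0 < eps / 2 by rewrite divr_gt0.
have [x' sx hx'] := periph_approx hx e1; have [y' sy hy'] := periph_approx hy e2.
exists (a *: x' + y'); first exact: span_scaleD.
move=> v; have -> : (a *: x + y - (a *: x' + y')) v = a *: (x - x') v + (y - y') v.
  by rewrite !fctE scalerBr opprD addrACA.
apply: (le_trans (nrD _ _)); rewrite nrZ -/c.
have -> : eps * nr v = eps / 2 * nr v + eps / 2 * nr v by rewrite -mulrDl -splitr.
apply: lerD; last exact: hy'.
apply: (@le_trans _ _ (c * (eps / (2 * (c + 1)) * nr v))); first by rewrite ler_wpM2l.
rewrite mulrA ler_wpM2r ?nr_ge0 //.
rewrite mulrCA ler_wpM2l ?(ltW e0) // ler_pdivrMr ?mulr_gt0 ?ltr_wpDl //.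
by rewrite mulrA mulVf ?mul1r ?lerDl.
Qed.

Lemma eig_periph a x : `|a| = 1 -> eig a x -> B x.
Proof. by move=> ha hx; apply: span_periph; exact: eig_span hx. Qed.

Lemma fixed_periph x : eig 1 x -> B x.
Proof. by apply: eig_periph; rewrite normr1. Qed.

(** * Cesaro means of the iterates and their limit *)

Definition cesaro N (x : F -> F) : F -> F :=
  (N.+1%:R^-1 : R)%:C *: \sum_(k < N.+1) iter k P x.

Let invN0 N : 0 <= (N.+1%:R^-1 : R).
Proof. by rewrite invr_ge0. Qed.

Lemma cesaro_bounded N x : bounded_op x -> bounded_op (cesaro N x).
Proof. by move=> bx; apply: boundedZ; apply: bounded_sum => k _; exact: iter_bounded. Qed.

Lemma cesaro_opb N x M : bounded_op x -> 0 <= M -> opb x M -> opb (cesaro N x) M.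
Proof.
move=> bx M0 hx v; rewrite /cesaro !fctE fct_sumE nrZr ger0_norm ?invN0 //.
rewrite ler_pdivrMl //; apply: (le_trans (nr_sum _ _ _)).
apply: (@le_trans _ _ (\sum_(k < N.+1) M * nr v)).
  by apply: ler_sum => k _; exact: iter_opb.
by rewrite sumr_const card_ord mulr_natl.
Qed.

Lemma cesaro_scaleD N a x y : bounded_op x -> bounded_op y ->
  cesaro N (a *: x + y) = a *: cesaro N x + cesaro N y.
Proof.
move=> bx bY; rewrite /cesaro; under eq_bigr do rewrite iter_scaleD //.
by rewrite big_split /= -scaler_sumr scalerDr !scalerA mulrC.
Qed.

Lemma cesaro_psd N n (X : 'I_n -> 'I_n -> F -> F) : (forall i j, bounded_op (X i j)) ->
  psd dF X -> psd dF (fun i j => cesaro N (X i j)).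
Proof.
by move=> bX hX; apply: psdZ => //; apply: psd_sum => k _; exact: iter_psd.
Qed.

Lemma cesaro_fixed N x : eig 1 x -> cesaro N x = x.
Proof.
move=> hx; rewrite /cesaro; under eq_bigr do rewrite iter_fixed //.
rewrite sumr_const card_ord -[x *+ _]scaler_nat scalerA -(rmorph_nat (real_complex R)) -rmorphM.
by rewrite mulVf ?pnatr_eq0 // scale1r.
Qed.

(** Applying P shifts the sum by one index, so only the end terms differ. Their contribution is O(1
    / N) on bounded operators, which makes the limit of the means a fixed point. *)
Lemma cesaro_P N x : bounded_op x ->
  P (cesaro N x) = cesaro N x + (N.+1%:R^-1 : R)%:C *: (iter N.+1 P x - x).
Proof.
move=> bx; have bk k : bounded_op (iter k P x) by exact: iter_bounded.
rewrite /cesaro PZ; last by apply: bounded_sum.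
rewrite P_sum // -scalerDr; congr (_ *: _).
rewrite [in RHS]big_ord_recl /= big_ord_recr /= addrACA.
by rewrite [x + _]addrC -addrA [x + _]addrC subrK addrC.
Qed.

(** A rate that is uniform in the vector and additive, so that it passes from eigenvectors to their
    finite sums. *)
Definition cesaro_rate (x y : F -> F) :=
  exists2 K : R, 0 <= K & forall N, opb (cesaro N x - y) (K * N.+1%:R^-1).

(** Away from a = 1, the geometric sum s of the powers of a satisfies (a - 1) s = a^(N+1) - 1, so
    |s| is at most 2 / |a - 1|: this is the origin of the constant 2 / c * M. *)
Lemma cesaro_eig a x : `|a| = 1 -> eig a x -> exists2 y, eig 1 y & cesaro_rate x y.
Proof.
move=> ha hx; have [a1|a1] := eqVneq a 1.
  exists x; first by rewrite -a1.
  exists 0 => // N v; rewrite cesaro_fixed -?a1 // subrr mul0r.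
  by rewrite -[X in nr X]/(0 : F) nr0 mul0r.
exists 0; first exact: eig0.
have [bx _] := hx; have /bounded_opP[lx [M M0 hM]] := bx.
set c := complex.Re `|a - 1|.
have ec : `|a - 1| = c%:C by rewrite RRe_real ?normr_real.
have c0 : 0 < c by rewrite -ltcR -ec normr_gt0 subr_eq0.
exists (2 / c * M); first by rewrite mulr_ge0 // divr_ge0 // ltW.
move=> N v; rewrite subr0 /cesaro; under eq_bigr do rewrite (iter_eig _ hx).
rewrite -scaler_suml !fctE nrZr ger0_norm // nrZ.
have hz : complex.Re `|\sum_(k < N.+1) a ^+ k| <= 2 / c.
  set z := \sum_k _; have [p ep] : exists p : R, `|z| = p%:C.
    by exists (complex.Re `|z|); rewrite RRe_real ?normr_real.
  rewrite ep ler_pdivlMr // -lecR.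
  have -> : (p * c)%:C = `|z| * `|a - 1| by rewrite ep ec rmorphM.
  rewrite -normrM mulrC -subrX1.
  by rewrite (le_trans (ler_normB _ _)) // normrX ha expr1n normr1 rmorph_nat.
have -> : 2 / c * M * N.+1%:R^-1 * nr v = N.+1%:R^-1 * (2 / c * (M * nr v)).
  by rewrite mulrAC mulrC !mulrA.
apply: ler_wpM2l => //; apply: ler_pM; [|exact: nr_ge0|exact: hz|exact: hM].
by rewrite -ler0c RRe_real ?normr_real.
Qed.

Lemma cesaro_rateD x y x' y' : bounded_op x -> bounded_op x' ->
  cesaro_rate x y -> cesaro_rate x' y' -> cesaro_rate (x + x') (y + y').
Proof.
move=> bx bx' [K K0 hK] [K' K0' hK']; exists (K + K'); first exact: addr_ge0.
move=> N v; rewrite -[x]scale1r cesaro_scaleD // scale1r.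
have -> : (cesaro N x + cesaro N x' - (y + y')) v =
    (cesaro N x - y) v + (cesaro N x' - y') v by rewrite !fctE opprD addrACA.
rewrite (le_trans (nrD _ _)) // [(K + K') * _]mulrDl [(_ + _) * nr v]mulrDl.
by apply: lerD; [exact: hK|exact: hK'].
Qed.

Lemma cesaro_span x : span x -> exists2 y, eig 1 y & cesaro_rate x y.
Proof.
move=> /spanP[n [lam [f [hf ->]]]]; elim: n lam f hf => [|n IH] lam f hf.
  rewrite big_ord0; exists 0; first exact: eig0.
  exists 0 => // N v; rewrite cesaro_fixed ?subrr; last exact: eig0.
  by rewrite -[X in nr X]/(0 : F) nr0 !mul0r.
pose w := widen_ord (leqnSn n).
have [|y hy ry] := IH (fun k => lam (w k)) (fun k => f (w k)).
  by move=> k; exact: hf.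
have [h1 h2] := hf ord_max; have [z hz rz] := cesaro_eig h1 h2.
exists (y + z); first exact: eigD.
rewrite big_ord_recr; apply: cesaro_rateD => //; last by case: h2.
by apply: bounded_sum => k _; case: (hf (w k)) => _ [].
Qed.

Let invN_to0 : (N.+1%:R^-1 : R) @[N --> \oo] --> (0 : R).
Proof. exact: (@cvg_harmonic R). Qed.

Lemma cesaro_cvgn x v : B x -> cvgn (cesaro ^~ x ^~ v).
Proof.
move=> hx; apply: cvg_nr_cauchy => e e0.
(* The error from replacing x by y and the rate of the means of y each cost e / 4 at v; every late
   mean is then within e / 2 of z v, and two of them within e. *)
have d0 : 0 < e / (4 * (nr v + 1)) by rewrite divr_gt0 // mulr_gt0 // ltr_wpDl ?nr_ge0.
have [y hy hxy] := periph_approx hx d0.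
have [z hz [K K0 hK]] := cesaro_span hy.
have e4 : 0 < e / 4 by rewrite divr_gt0.
have /cvgrPdist_lt/(_ _ e4)[N _ hN] := cvg0Mr (K * nr v) invN_to0.
have bx := periph_bounded hx; have bY := span_bounded hy.
have key m : (N <= m)%N -> nr (cesaro m x v - z v) < e / 2.
  move=> /hN; rewrite /= sub0r normrN ger0_norm ?mulr_ge0 ?nr_ge0 // => hm.
  have -> : cesaro m x v - z v = cesaro m (x - y) v + (cesaro m y - z) v.
    rewrite [x - y]addrC -scaleN1r cesaro_scaleD // !fctE scaleN1r.
    by rewrite addrAC addrA addNr add0r addrC.
  apply: (le_lt_trans (nrD _ _)).
  have h1 := cesaro_opb m (boundedB bx bY) (ltW d0) hxy v.
  have h2 := hK m v.
  have h3 : e / (4 * (nr v + 1)) * nr v <= e / 4.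
    rewrite invfM mulrA -mulrA ler_piMr ?(ltW e4) // mulrC ler_pdivrMr ?ltr_wpDl ?nr_ge0 //.
    by rewrite mul1r lerDl.
  have h4 : K * m.+1%:R^-1 * nr v < e / 4 by rewrite mulrAC mulrC.
  have h5 := le_trans h1 h3; have h6 := le_lt_trans h2 h4.
  by move: h5 h6; move: (nr _) (nr _) => p q h5 h6; lra.
exists N => m n hm hn; have -> : cesaro m x v - cesaro n x v =
    (cesaro m x v - z v) - (cesaro n x v - z v) by rewrite opprB subrKA.
apply: (le_lt_trans (nrD _ _)); rewrite nrN.
by have := key m hm; have := key n hn; lra.
Qed.

(** The value is meaningful on the peripheral boundary, where the means converge; elsewhere [lim]
    may return a default. *)
Definition expect (x : F -> F) (v : F) : F := lim (cesaro N x v @[N --> \oo]).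

Lemma expect_cvg x v : B x -> cesaro N x v @[N --> \oo] --> expect x v.
Proof. by move=> hx; exact: cesaro_cvgn. Qed.

Lemma expect_opb x M : B x -> 0 <= M -> opb x M -> opb (expect x) M.
Proof.
move=> hx M0 hM v; apply: (cvg_le (cvg_nr (expect_cvg hx))) => N.
by apply: cesaro_opb => //; exact: periph_bounded.
Qed.

Lemma expect_scaleD a x y : B x -> B y ->
  expect (a *: x + y) = a *: expect x + expect y.
Proof.
move=> hx hy; have bx := periph_bounded hx; have bY := periph_bounded hy.
apply/funext => v; apply/cvg_lim => //.
under eq_fun do rewrite cesaro_scaleD //.
by apply: cvgD; [apply: cvgZl_tmp|]; exact: expect_cvg.
Qed.

Lemma expect_fixed x : eig 1 x -> expect x = x.
Proof.
move=> hx; apply/funext => v; apply/cvg_lim => //.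
by under eq_fun do rewrite cesaro_fixed //; exact: cvg_cst.
Qed.

Lemma expect_eig x : B x -> eig 1 (expect x).
Proof.
move=> hx; have bx := periph_bounded hx; have /bounded_opP[lx [M M0 hM]] := bx.
have bc N : bounded_op (cesaro N x) by exact: cesaro_bounded.
have oc N : opb (cesaro N x) M by exact: cesaro_opb.
have cc v := @expect_cvg x v hx.
split; first by apply: (bounded_lim M0 _ oc cc) => N; exact: bounded_lin.
apply/funext => v; rewrite scale1r.
(* By normality P ([expect x]) v is the limit of P applied to the means, which by [cesaro_P] differs
   from the means themselves by at most 2 M |v| / (N + 1). *)
have h := @P_normal (cesaro ^~ x) (expect x) M v M0 bc oc cc.
rewrite -(cvg_lim _ h) //; apply/cvg_lim => //.
rewrite -[expect x v]addr0; under eq_fun do rewrite cesaro_P //.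
apply: cvgD; first exact: cc.
apply: (@cvg_nr_bound _ _ _ _ (fun N => N.+1%:R^-1 * ((M + M) * nr v))).
  move=> N; rewrite subr0 nrZr ger0_norm // ler_wpM2l //.
  by apply: opbB => //; exact: iter_opb.
exact: cvg0Mr.
Qed.

Lemma expect_psd n (X : 'I_n -> 'I_n -> F -> F) : (forall i j, B (X i j)) ->
  psd dF X -> psd dF (fun i j => expect (X i j)).
Proof.
move=> bX hX; apply: (@psd_lim _ _ _ HF _ (fun N i j => cesaro N (X i j))).
  by move=> i j w; exact: expect_cvg.
by move=> N; apply: cesaro_psd => // i j; exact: periph_bounded.
Qed.

(** * Adjoints and linear structure of the peripheral boundary *)

Local Notation "x ^†" := (adjoint dF x) (at level 2, format "x ^†").

Lemma eig_adjoint a x : eig a x -> eig (conjc a) x^†.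
Proof.
move=> [bx hx]; have h := adjoint_ex HF bx; have bx' := adjp_bounded HF bx h.
split=> //; apply: (@adjp_uniq _ _ _ HF (P x)); first exact: P_adjp.
by rewrite hx; apply: adjpZ => //; exact: bounded_lin.
Qed.

Lemma span_adjoint x : span x -> span x^†.
Proof.
move=> sx; have bx := span_bounded sx; move/spanP: (sx) => [n [lam [f [hf e]]]].
apply/spanP; exists n, (fun k => conjc (lam k)), (fun k => (f k)^†); split=> [k|].
  by have [h1 h2] := hf k; rewrite normcJ; split=> //; exact: eig_adjoint.
apply: adjp_adjoint => //; rewrite e; apply: adjp_sum => k _; apply: adjoint_ex => //.
by case: (hf k) => _ [].
Qed.

Lemma adjoint_opbB x y M : bounded_op x -> bounded_op y -> 0 <= M ->
  opb (x - y) M -> opb (x^† - y^†) M.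
Proof.
move=> bx bY M0 h; apply: (adjp_opb HF M0 h).
by apply: adjpD; [exact: adjoint_ex|apply: adjpN; exact: adjoint_ex].
Qed.

Lemma adjoint_bounded x : bounded_op x -> bounded_op x^†.
Proof. by move=> bx; apply: (adjp_bounded HF bx); exact: adjoint_ex. Qed.

Lemma periph_adjoint x : B x -> B x^†.
Proof.
move=> hx; have bx := periph_bounded hx; apply: periph_of_approx.
  exact: adjoint_bounded.
move=> eps e0; have [y sy hy] := periph_approx hx e0.
exists y^†; first exact: span_adjoint.
by apply: adjoint_opbB => //; [exact: span_bounded|exact: ltW].
Qed.

Lemma periph0 : B 0.
Proof. by apply: fixed_periph; exact: eig0. Qed.

Lemma periphD x y : B x -> B y -> B (x + y).
Proof. by move=> hx hy; rewrite -[x]scale1r; exact: periph_scaleD. Qed.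

Lemma periphZ a x : B x -> B (a *: x).
Proof. by move=> hx; rewrite -[a *: x]addr0; apply: periph_scaleD => //; exact: periph0. Qed.

Lemma periphN x : B x -> B (- x).
Proof. by move=> hx; rewrite -scaleN1r; exact: periphZ. Qed.

Lemma periphB x y : B x -> B y -> B (x - y).
Proof. by move=> hx hy; apply: periphD => //; exact: periphN. Qed.

Lemma periph_sum (I : Type) (r : seq I) (Q : pred I) (f : I -> F -> F) :
  (forall i, Q i -> B (f i)) -> B (\sum_(i <- r | Q i) f i).
Proof. by move=> h; elim/big_ind: _ => //; [exact: periph0|exact: periphD]. Qed.

(** * The modified Choi-Effros product *)

Variable circ : (F -> F) -> (F -> F) -> F -> F.
Hypothesis Hcirc : modified_choi_effros P circ.

Lemma circ_periph x y : B x -> B y -> B (circ x y).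
Proof. by case: Hcirc => h _ _ _; exact: h. Qed.

Lemma circ_scaleDl a x x' y : B x -> B x' -> B y ->
  circ (a *: x + x') y = a *: circ x y + circ x' y.
Proof. by case: Hcirc => _ [h _] _ _; exact: h. Qed.

Lemma circ_scaleDr a x y y' : B x -> B y -> B y' ->
  circ x (a *: y + y') = a *: circ x y + circ x y'.
Proof. by case: Hcirc => _ [_ h] _ _; exact: h. Qed.

Lemma circDl x x' y : B x -> B x' -> B y -> circ (x + x') y = circ x y + circ x' y.
Proof. by move=> hx hx' hy; have := circ_scaleDl 1 hx hx' hy; rewrite !scale1r. Qed.

Lemma circDr x y y' : B x -> B y -> B y' -> circ x (y + y') = circ x y + circ x y'.
Proof. by move=> hx hy hy'; have := circ_scaleDr 1 hx hy hy'; rewrite !scale1r. Qed.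

Lemma circ0l y : B y -> circ 0 y = 0.
Proof.
move=> hy; have := circDl periph0 periph0 hy.
by rewrite addr0 => /eqP; rewrite -subr_eq subrr eq_sym => /eqP.
Qed.

Lemma circ0r x : B x -> circ x 0 = 0.
Proof.
move=> hx; have := circDr hx periph0 periph0.
by rewrite addr0 => /eqP; rewrite -subr_eq subrr eq_sym => /eqP.
Qed.

Lemma circZl a x y : B x -> B y -> circ (a *: x) y = a *: circ x y.
Proof.
by move=> hx hy; rewrite -[a *: x]addr0 circ_scaleDl ?circ0l ?addr0 //; exact: periph0.
Qed.

Lemma circZr a x y : B x -> B y -> circ x (a *: y) = a *: circ x y.
Proof.
by move=> hx hy; rewrite -[a *: y]addr0 circ_scaleDr ?circ0r ?addr0 //; exact: periph0.
Qed.

Lemma circBl x x' y : B x -> B x' -> B y -> circ (x - x') y = circ x y - circ x' y.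
Proof.
move=> hx hx' hy; rewrite circDl //; last exact: periphN.
by rewrite -scaleN1r circZl // scaleN1r.
Qed.

Lemma circBr x y y' : B x -> B y -> B y' -> circ x (y - y') = circ x y - circ x y'.
Proof.
move=> hx hy hy'; rewrite circDr //; last exact: periphN.
by rewrite -[- y']scaleN1r circZr // scaleN1r.
Qed.

Lemma circ_suml (I : Type) (r : seq I) (f : I -> F -> F) y :
  (forall i, B (f i)) -> B y ->
  circ (\sum_(i <- r) f i) y = \sum_(i <- r) circ (f i) y.
Proof.
move=> hf hy; elim: r => [|i r IH]; first by rewrite !big_nil circ0l.
by rewrite !big_cons circDl ?IH //; exact: periph_sum.
Qed.

Lemma circ_sumr (I : Type) (r : seq I) (f : I -> F -> F) x :
  (forall i, B (f i)) -> B x ->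
  circ x (\sum_(i <- r) f i) = \sum_(i <- r) circ x (f i).
Proof.
move=> hf hx; elim: r => [|i r IH]; first by rewrite !big_nil circ0r.
by rewrite !big_cons circDr ?IH //; exact: periph_sum.
Qed.

(** Turns the epsilon-delta norm continuity of [circ] into pointwise convergence along approximants
    at distance 1 / (N + 1). *)
Lemma circ_cvg (xs ys : nat -> F -> F) x y v :
  B x -> B y -> (forall N, B (xs N)) -> (forall N, B (ys N)) ->
  (forall N, opb (x - xs N) N.+1%:R^-1) -> (forall N, opb (y - ys N) N.+1%:R^-1) ->
  circ (xs N) (ys N) v @[N --> \oo] --> circ x y v.
Proof.
move=> hx hy hxs hys ox oy; apply/cvg_nrP/cvgrPdist_lt => e e0.
have d0 : 0 < e / (nr v + 1) by rewrite divr_gt0 // ltr_wpDl ?nr_ge0.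
have [_ _ h _] := Hcirc; have [del del0 hdel] := h x y hx hy _ d0.
have /cvgrPdist_lt/(_ _ del0) := invN_to0; apply: filterS => N.
rewrite sub0r normrN ger0_norm // => hN.
have op (z z' : F -> F) : opb (z - z') N.+1%:R^-1 -> opnorm (z' - z) < del.
  move=> oz; apply: le_lt_trans hN; apply: opnorm_le => // w.
  by rewrite -opprB -[X in nr X]/(- ((z - z') w)) nrN.
have := hdel _ _ (hxs N) (hys N) (op _ _ (ox N)) (op _ _ (oy N)).
set D := circ _ _ - _ => hD; rewrite sub0r normrN ger0_norm ?nr_ge0 //.
have bD : bounded_op D.
  by apply: periph_bounded; apply: periphB; exact: circ_periph.
apply: (@le_lt_trans _ _ (opnorm D * nr v)); first exact: (opnorm_opb bD v).
apply: (@le_lt_trans _ _ (opnorm D * (nr v + 1))).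
  by rewrite ler_wpM2l ?lerDl // opnorm_ge0.
by rewrite -ltr_pdivlMr // ltr_wpDl ?nr_ge0.
Qed.

Lemma circ_eig_cvg a b x y v : `|a| = 1 -> `|b| = 1 -> eig a x -> eig b y ->
  ((a * b) ^- m *: iter m P (x \o y) v) @[m --> \oo] --> circ x y v.
Proof. by case: Hcirc => _ _ _ h ha hb hx hy; exact: h. Qed.

Lemma circ_fixed_cvg x y v : eig 1 x -> eig 1 y ->
  iter m P (x \o y) v @[m --> \oo] --> circ x y v.
Proof.
move=> hx hy; have := @circ_eig_cvg 1 1 x y v (normr1 _) (normr1 _) hx hy.
by under eq_fun do rewrite mulr1 expr1n invr1 scale1r.
Qed.

Lemma eig1_lim (u : nat -> F -> F) x M : 0 <= M -> (forall m, eig 1 (u m)) ->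
  (forall m, opb (u m) M) -> (forall v, u m v @[m --> \oo] --> x v) -> eig 1 x.
Proof.
move=> M0 hu ou hx; have bu m : bounded_op (u m) by case: (hu m).
split; first by apply: (bounded_lim M0 _ ou hx) => m; exact: bounded_lin.
apply/funext => v; rewrite scale1r.
have h := @P_normal u x M v M0 bu ou hx; rewrite -(cvg_lim _ h) //; apply/cvg_lim => //.
have e m : P (u m) = u m by have [_ ->] := hu m; rewrite scale1r.
by under eq_fun do rewrite e; exact: hx.
Qed.

(** P only shifts the index of the bounded convergent sequence P^m (x y), so by normality it fixes
    the limit. *)
Lemma circ_fixed x y : eig 1 x -> eig 1 y -> eig 1 (circ x y).
Proof.
move=> hx hy; have [bx _] := hx; have [bY _] := hy.
have bxy := bounded_comp bx bY; have /bounded_opP[_ [M M0 hM]] := bxy.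
split; first by apply/periph_bounded/circ_periph; exact: fixed_periph.
have bi m : bounded_op (iter m P (x \o y)) by exact: iter_bounded.
have oi m : opb (iter m P (x \o y)) M by exact: iter_opb.
have ci v := @circ_fixed_cvg _ _ v hx hy.
apply/funext => v; rewrite scale1r.
have h := @P_normal _ _ M v M0 bi oi ci; rewrite -(cvg_lim _ h) //; apply/cvg_lim => //.
by have := ci v; rewrite -(cvg_shiftS (fun m => iter m P (x \o y) v)).
Qed.

Lemma circ_adjp x x' y y' : eig 1 x -> eig 1 x' -> eig 1 y -> eig 1 y' ->
  adjp dF x x' -> adjp dF y y' -> adjp dF (circ x y) (circ y' x').
Proof.
move=> hx hx' hy hy' h h'; apply: (@adjp_lim _ _ _ HF (fun m => iter m P (x \o y))
  (fun m => iter m P (y' \o x'))).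
- by move=> w; exact: circ_fixed_cvg.
- by move=> w; exact: circ_fixed_cvg.
have [bx _] := hx; have [bx' _] := hx'; have [bY _] := hy; have [bY' _] := hy'.
by move=> m; apply: iter_adjp; [exact: bounded_comp|exact: bounded_comp|exact: adjp_comp].
Qed.

Lemma circ_idl x : eig 1 x -> circ id x = x.
Proof.
move=> hx; apply/funext => v; have h := @circ_fixed_cvg _ _ v eig_id hx.
rewrite -(cvg_lim _ h) //; apply/cvg_lim => //.
by under eq_fun do rewrite (_ : id \o x = x) // iter_fixed //; exact: cvg_cst.
Qed.

Lemma circ_idr x : eig 1 x -> circ x id = x.
Proof.
move=> hx; apply/funext => v; have h := @circ_fixed_cvg _ _ v hx eig_id.
rewrite -(cvg_lim _ h) //; apply/cvg_lim => //.
by under eq_fun do rewrite (_ : x \o id = x) // iter_fixed //; exact: cvg_cst.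
Qed.

(** * Matrices over the Poisson boundary and their square roots *)

Definition mulc n (X Y : 'I_n -> 'I_n -> F -> F) i j : F -> F :=
  \sum_k circ (X i k) (Y k j).

Definition idmx n (i j : 'I_n) : F -> F := if i == j then id else 0.

Section SquareRoot.
Variable n : nat.
Implicit Types X Y Z : 'I_n -> 'I_n -> F -> F.

Let fixed X := forall i j, eig 1 (X i j).
Let periph X := forall i j, B (X i j).

Let fixed_B X : fixed X -> periph X.
Proof. by move=> h i j; exact: fixed_periph. Qed.

Lemma mulc_fixed X Y : fixed X -> fixed Y -> fixed (mulc X Y).
Proof. by move=> hX hY i j; apply: eig_sum => k _; exact: circ_fixed. Qed.

Lemma mulc_herm X : fixed X -> herm dF X -> herm dF (mulc X X).
Proof. by move=> fX hX i j; apply: adjp_sum => k _; apply: circ_adjp. Qed.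

(** The product entries are pointwise limits of P^m applied to the entries of the composed operator
    matrix. Composition is submultiplicative, P^m keeps norm bounds of matrices, and such bounds are
    closed under pointwise limits. *)
Lemma mulc_wbound X Y M N : fixed X -> fixed Y -> 0 <= M -> 0 <= N ->
  wbound dF X M -> wbound dF Y N -> wbound dF (mulc X Y) (M * N).
Proof.
move=> fX fY M0 N0 hX hY; have bX i j : bounded_op (X i j) by case: (fX i j).
have bY i j : bounded_op (Y i j) by case: (fY i j).
have bXY i j k : bounded_op (X i k \o Y k j) by exact: bounded_comp.
apply: (@wbound_lim _ _ _ HF _ (fun m i j => iter m P (\sum_k (X i k \o Y k j)))).
  move=> i j w /=; rewrite /mulc fct_sumE.
  have e m : iter m P (\sum_k (X i k \o Y k j)) w = \sum_k iter m P (X i k \o Y k j) w.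
    by rewrite iter_sum // fct_sumE.
  by under eq_fun do rewrite e; apply: cvg_sumr => k _; exact: circ_fixed_cvg.
move=> m; apply: iter_wbound; first by move=> i j; exact: bounded_sum.
by apply: wbound_comp => // i j; exact: bounded_lin.
Qed.

Lemma mulcBl X Y Z i j : periph X -> periph Y -> periph Z ->
  mulc (fun i j => X i j - Y i j) Z i j = mulc X Z i j - mulc Y Z i j.
Proof. by move=> hX hY hZ; rewrite -sumrB; apply: eq_bigr => k _; rewrite circBl. Qed.

Lemma mulcBr X Y Z i j : periph X -> periph Y -> periph Z ->
  mulc Z (fun i j => X i j - Y i j) i j = mulc Z X i j - mulc Z Y i j.
Proof. by move=> hX hY hZ; rewrite -sumrB; apply: eq_bigr => k _; rewrite circBr. Qed.

Lemma idmx_fixed : fixed (@idmx n).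
Proof. by move=> i j; rewrite /idmx; case: ifP => _; [exact: eig_id|exact: eig0]. Qed.

Lemma idmx_herm : herm dF (@idmx n).
Proof.
move=> i j; rewrite /idmx eq_sym; case: ifP => _; last exact: adjp0.
by move=> u v.
Qed.

Lemma form_idmx u : form dF (@idmx n) u u = sqn u.
Proof.
apply: eq_bigr => i _; rewrite (bigD1 i) //= /idmx eqxx (rdvv HF) big1 ?addr0 //.
by move=> j /negPf; rewrite eq_sym => ->; exact: rd0l.
Qed.

Lemma mulc_idl X i j : fixed X -> mulc (@idmx n) X i j = X i j.
Proof.
move=> fX; rewrite /mulc (bigD1 i) //= /idmx eqxx circ_idl // big1 ?addr0 //.
by move=> k /negPf; rewrite eq_sym => ->; apply: circ0l; exact: fixed_B.
Qed.

Lemma mulc_idr X i j : fixed X -> mulc X (@idmx n) i j = X i j.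
Proof.
move=> fX; rewrite /mulc (bigD1 j) //= /idmx eqxx circ_idr // big1 ?addr0 //.
by move=> k /negPf ->; apply: circ0r; exact: fixed_B.
Qed.

Variables (Y : 'I_n -> 'I_n -> F -> F) (fY : fixed Y) (hY : herm dF Y)
  (wY : wbound dF Y 1).

(* The iteration [S <- (Y + S o S) / 2] is dominated in norm by its scalar
   counterpart [s <- (1 + s^2) / 2]; this uses only that [o] is bilinear and
   submultiplicative, not that it is associative. *)
Fixpoint sqrt_iter (k : nat) : 'I_n -> 'I_n -> F -> F :=
  if k is k'.+1 then fun i j =>
    (2^-1 : R)%:C *: (Y i j + mulc (sqrt_iter k') (sqrt_iter k') i j)
  else fun _ _ => 0.

Fixpoint scalar_iter (k : nat) : R :=
  if k is k'.+1 then 2^-1 * (1 + scalar_iter k' * scalar_iter k') else 0.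

Local Notation S := sqrt_iter.
Local Notation s := scalar_iter.

Let s_bounds k : 0 <= s k <= 1.
Proof.
elim: k => [|k /andP[h0 h1]] /=; first by rewrite lexx ler01.
have h2 : 0 <= s k * s k <= 1 by rewrite mulr_ge0 // mulr_ile1.
by case/andP: h2 => h2 h3; apply/andP; split; lra.
Qed.

Let s_ge0 k : 0 <= s k. Proof. by case/andP: (s_bounds k). Qed.
Let s_le1 k : s k <= 1. Proof. by case/andP: (s_bounds k). Qed.

Let s_mono k : s k <= s k.+1.
Proof. by rewrite /=; have := sqr_ge0 (1 - s k); rewrite sqrrB expr1n expr2; lra. Qed.

(** The defect t = 1 - s k obeys t' = t - t^2 / 2, a discrete form of dt/dk = - t^2 / 2, which has
    the solution 2 / k. *)
Let s_rate k : 1 - s k <= 2 / k.+2%:R.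
Proof.
have aux (b t : R) : 2 <= b -> 0 <= t -> t <= 2 / b -> t - t ^+ 2 / 2 <= 2 / (b + 1).
  move=> b2 t0; have b0 : 0 < b by apply: lt_le_trans b2.
  have b1 : 0 < b + 1 by rewrite addr_gt0.
  rewrite !ler_pdivlMr // => tb.
  have t1 : t <= 1 by nra.
  (* The claim is that 2 - (t - t^2 / 2) (b + 1) is nonnegative; it equals this product plus t^2 /
     2. *)
  have : 0 <= (2 - t * b) * (1 - t / 2) by rewrite mulr_ge0 ?subr_ge0 //; lra.
  by have := sqr_ge0 t; nra.
elim: k => [|k IH]; first by rewrite /= subr0 divff.
have -> : 1 - s k.+1 = (1 - s k) - (1 - s k) ^+ 2 / 2.
  by rewrite /=; move: (s k) => a; field.
rewrite -[k.+3]addn1 natrD; apply: aux => //; first by rewrite ler_nat.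
by rewrite subr_ge0.
Qed.

Let s_to1 : (1 - s k) @[k --> \oo] --> (0 : R).
Proof.
apply: (@cvg_dist_bound _ _ (fun k => k.+1%:R^-1 * 2)); last exact: cvg0Mr.
move=> k; rewrite subr0 ger0_norm ?subr_ge0 //; apply: (le_trans (s_rate k)).
by rewrite mulrC ler_wpM2r // lef_pV2 ?posrE // ler_nat.
Qed.

Let S_fixed k : fixed (S k).
Proof.
elim: k => [|k IH] i j; first exact: eig0.
by apply: eigZ; apply: eigD => //; exact: mulc_fixed.
Qed.

Let S_herm k : herm dF (S k).
Proof.
elim: k => [|k IH] i j; first exact: adjp0.
move=> u v /=; rewrite !fctE rdZl rdZr !(rdDl, rdDr) hY.
by rewrite (mulc_herm (S_fixed k) IH).
Qed.

Let S_wbound k : wbound dF (S k) (s k).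
Proof.
elim: k => [|k IH].
  move=> u v; rewrite /= mul0r /form big1 ?mulr0 // => i _; rewrite big1 // => j _.
  exact: rd0l.
apply: wboundZ; first by rewrite invr_ge0.
by apply: wboundD => //; exact: mulc_wbound.
Qed.

Let eq_wbound X X' M : (forall i j, X i j = X' i j) -> wbound dF X M -> wbound dF X' M.
Proof.
by move=> h; have -> : X = X' by apply/funext => i; apply/funext => j.
Qed.

(** X o X - X' o X' = (X - X') o X + X' o (X - X'), with the order of the factors kept. *)
Let mulc_dist X X' M M' d : fixed X -> fixed X' -> 0 <= M -> 0 <= M' -> 0 <= d ->
  wbound dF X M -> wbound dF X' M' -> wbound dF (fun i j => X i j - X' i j) d ->
  wbound dF (fun i j => mulc X X i j - mulc X' X' i j) (d * M + M' * d).
Proof.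
move=> fX fX' M0 M0' d0 hX hX' hd.
have fD : fixed (fun i j => X i j - X' i j).
  by move=> i j; rewrite -[X i j]scale1r addrC -scaleN1r; apply: eig_scaleD => //; exact: eigZ.
apply: (@eq_wbound (fun i j => mulc (fun i j => X i j - X' i j) X i j +
    mulc X' (fun i j => X i j - X' i j) i j)).
  by move=> i j; rewrite mulcBl ?mulcBr ?subrKA //; exact: fixed_B.
by apply: wboundD; exact: mulc_wbound.
Qed.

(** The increments of [s] satisfy with equality the recursion that [mulc_dist] gives as a bound for
    the increments of [S], so the domination propagates. *)
Let S_step k : wbound dF (fun i j => S k.+1 i j - S k i j) (s k.+1 - s k).
Proof.
elim: k => [|k IH].
  apply: (@eq_wbound (S 1)); first by move=> i j; rewrite /= subr0.
  by rewrite [s 0]/= subr0; exact: S_wbound.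
apply: (@eq_wbound (fun i j => (2^-1 : R)%:C *:
    (mulc (S k.+1) (S k.+1) i j - mulc (S k) (S k) i j))).
  by move=> i j; rewrite -scalerBr opprD addrACA subrr add0r.
have -> : s k.+2 - s k.+1 =
    2^-1 * ((s k.+1 - s k) * s k.+1 + s k * (s k.+1 - s k)).
  have aux (a b : R) : b = 2^-1 * (1 + a * a) ->
      2^-1 * (1 + b * b) - b = 2^-1 * ((b - a) * b + a * (b - a)).
    by move=> h; lra.
  exact: aux.
apply: wboundZ; first by rewrite invr_ge0.
by apply: mulc_dist => //; rewrite subr_ge0.
Qed.

Let S_dist k p : wbound dF (fun i j => S (p + k) i j - S k i j) (s (p + k) - s k).
Proof.
elim: p => [|p IH].
  move=> u v; rewrite !add0n subrr mul0r /form big1 ?mulr0 // => i _; rewrite big1 // => j _.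
  by rewrite subrr; exact: rd0l.
apply: (@eq_wbound (fun i j => (S (p.+1 + k) i j - S (p + k) i j) +
    (S (p + k) i j - S k i j))); first by move=> i j; rewrite subrKA.
have -> : s (p.+1 + k) - s k = (s (p.+1 + k) - s (p + k)) + (s (p + k) - s k).
  by rewrite subrKA.
by apply: wboundD => //; exact: S_step.
Qed.

Let fixed_lin X : fixed X -> forall i j, linear (X i j).
Proof. by move=> fX i j; case: (fX i j) => /bounded_lin. Qed.

Let S_opb k i j : opb (S k i j) 1.
Proof.
by apply: wbound_entry => //; [exact: fixed_lin|exact: wbound_le (S_wbound k) (s_le1 k)].
Qed.

Let fixed_sub X X' : fixed X -> fixed X' -> fixed (fun i j => X i j - X' i j).
Proof.
by move=> fX fX' i j; rewrite addrC -scaleN1r; apply: eig_scaleD.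
Qed.

Let S_dist_le k p : wbound dF (fun i j => S (p + k) i j - S k i j) (1 - s k).
Proof. by apply: wbound_le (S_dist k p) _; rewrite lerD2r. Qed.

Let S_cvgn i j v : cvgn (S ^~ i ^~ j ^~ v).
Proof.
apply: cvg_nr_cauchy => e e0.
have /cvgrPdist_lt/(_ _ e0)[N _ hN] := cvg0Mr (2 * nr v) s_to1.
exists N => m p hm hp; have := hN _ (leqnn N); rewrite /= sub0r normrN ger0_norm; last first.
  by rewrite mulr_ge0 ?subr_ge0 // mulr_ge0 ?nr_ge0.
apply: le_lt_trans.
have key q : (N <= q)%N -> nr (S q i j v - S N i j v) <= (1 - s N) * nr v.
  move=> hq; rewrite -(subnK hq).
  have := @wbound_entry _ _ _ HF _ _ _ _ _ (S_dist_le N (q - N)%N) i j v.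
  apply; first by rewrite subr_ge0.
  by apply: fixed_lin; exact: fixed_sub.
rewrite -(subrK (S N i j v) (S m i j v)) -addrA (le_trans (nrD _ _)) // [X in _ + X]nrC.
by have := key m hm; have := key p hp; move: (nr _) (nr _) (s N) (nr v) => a b c d; lra.
Qed.

Let T i j v : F := lim (S k i j v @[k --> \oo]).

Let T_cvg i j v : S k i j v @[k --> \oo] --> T i j v.
Proof. exact: S_cvgn. Qed.

Let T_fixed : fixed T.
Proof.
move=> i j.
by apply: (eig1_lim ler01 (fun k => S_fixed k i j) (fun k => S_opb k i j)) => v; exact: T_cvg.
Qed.

Let T_herm : herm dF T.
Proof.
move=> i j; apply: (@adjp_lim _ _ _ HF (fun k => S k i j) (fun k => S k j i)) => // k.
exact: S_herm.
Qed.

Let T_wbound : wbound dF T 1.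
Proof.
apply: (@wbound_lim _ _ _ HF _ S) => // k; exact: wbound_le (S_wbound k) (s_le1 k).
Qed.

Let T_dist k : wbound dF (fun i j => T i j - S k i j) (1 - s k).
Proof.
apply: (@wbound_lim _ _ _ HF _ (fun p i j => S (p + k) i j - S k i j)) => // i j w.
apply: cvgB; last exact: cvg_cst.
by have := T_cvg (i := i) (j := j) (v := w); rewrite -(cvg_shiftn k).
Qed.

Let T_eq i j : T i j = (2^-1 : R)%:C *: (Y i j + mulc T T i j).
Proof.
apply/funext => v; apply/cvg_lim => //.
rewrite -(cvg_shiftS (fun k => S k i j v)) /=.
apply: cvgZl_tmp; apply: cvgD; first exact: cvg_cst.
(* The factor 2 comes from [mulc_dist], with both T and [S k] bounded by 1 and at distance 1 - s
   k. *)
apply: (@cvg_nr_bound _ _ _ _ (fun k => (1 - s k) * (2 * nr v))); last exact: cvg0Mr.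
move=> k; rewrite nrC; have d0 : 0 <= 1 - s k by rewrite subr_ge0.
have w : wbound dF (fun i j => mulc T T i j - mulc (S k) (S k) i j) ((1 - s k) * 2).
  have -> : (1 - s k) * 2 = (1 - s k) * 1 + 1 * (1 - s k) by ring.
  apply: mulc_dist; [exact: T_fixed|exact: S_fixed|exact: ler01|exact: ler01|exact: d0
    |exact: T_wbound|exact: wbound_le (S_wbound k) (s_le1 k)|exact: T_dist].
rewrite mulrA; apply: (wbound_entry HF _ _ w); first by rewrite mulr_ge0.
by apply: fixed_lin; apply: fixed_sub; exact: mulc_fixed.
Qed.

(** With Z = 1 - T, expanding Z o Z gives 1 - 2 T + T o T, and the fixed-point equation of T says
    that T o T = 2 T - Y. *)
Lemma one_sub_sqrt : exists Z, [/\ fixed Z, herm dF Z &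
  forall i j, mulc Z Z i j = idmx i j - Y i j].
Proof.
exists (fun i j => idmx i j - T i j); split.
- by apply: fixed_sub; [exact: idmx_fixed|exact: T_fixed].
- by move=> i j; apply: adjpD; [exact: idmx_herm|apply: adjpN; exact: T_herm].
move=> i j; have pI := fixed_B idmx_fixed; have pT := fixed_B T_fixed.
have pD : periph (fun i j => idmx i j - T i j) by move=> ? ?; exact: periphB.
rewrite (@mulcBl (@idmx n) T _ i j pI pT pD).
rewrite (@mulcBr (@idmx n) T (@idmx n) i j pI pT pI) (@mulcBr (@idmx n) T T i j pI pT pT).
rewrite (mulc_idl _ _ idmx_fixed) (mulc_idl _ _ T_fixed) (mulc_idr _ _ T_fixed).
have h : mulc T T i j = T i j + T i j - Y i j.
  rewrite [in RHS]T_eq -scalerDl -rmorphD /= (_ : 2^-1 + 2^-1 = 1 :> R); last by field.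
  by rewrite rmorph1 scale1r addrAC subrr add0r.
have -> : T i j - mulc T T i j = Y i j - T i j.
  by rewrite h -addrA opprD addrA subrr sub0r opprB.
by rewrite opprB subrKA.
Qed.

End SquareRoot.

(** The root is self-adjoint, so W o W is also W^* o W, the shape required of a positive matrix. *)
Lemma psd_square_root n (X : 'I_n -> 'I_n -> F -> F) : (forall i j, eig 1 (X i j)) ->
  psd dF X -> exists W : 'I_n -> 'I_n -> F -> F,
    [/\ forall i j, eig 1 (W i j), herm dF W & forall i j, X i j = mulc W W i j].
Proof.
move=> fX [hX pX].
have /choice[M hM] : forall p : 'I_n * 'I_n, exists M, 0 <= M /\ opb (X p.1 p.2) M.
  by move=> p; have [/bounded_opP[_ [M M0 h]] _] := fX p.1 p.2; exists M.
have M0 : 0 <= \sum_p M p by apply: sumr_ge0 => p _; case: (hM p).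
have hMM i j : opb (X i j) (\sum_p M p).
  apply: (opb_le (proj2 (hM (i, j)))); rewrite (bigD1 (i, j)) //= lerDl.
  by apply: sumr_ge0 => p _; case: (hM p).
have [K K0 hK] := form_le HF hMM M0; set K' := K + 1.
have Kp : 0 < K' by rewrite ltr_wpDl.
(* Since the form of X is at most K' times the squared norm, Y = 1 - X / K' lies between 0 and 1 and
   so has norm at most 1. Adding 1 to K keeps K' positive even if K = 0. *)
pose Y i j := idmx i j + (- K'^-1)%:C *: X i j.
have fY i j : eig 1 (Y i j) by apply: eigD; [exact: idmx_fixed|apply: eigZ].
have hY : herm dF Y.
  move=> i j; apply: adjpD; first exact: idmx_herm.
  by move=> u v; rewrite !fctE rdZl rdZr hX.
have formY u : form dF Y u u = sqn u - K'^-1 * form dF X u u.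
  by rewrite formDl formZl form_idmx mulNr.
have wY : wbound dF Y 1.
  apply: psd_wbound => [i j||u]; first by case: (fY i j) => /bounded_lin.
    split=> // u; rewrite formY subr_ge0 ler_pdivrMl //.
    by apply: (le_trans (hK u)); rewrite ler_wpM2r ?sqn_ge0 // lerDl.
  by rewrite formY mul1r gerBl mulr_ge0 // invr_ge0 ltW.
have [Z [fZ hZ eZ]] := one_sub_sqrt fY hY wY.
exists (fun i j => (Num.sqrt K')%:C *: Z i j); split=> [i j|i j u v|i j].
- exact: eigZ.
- by rewrite !fctE rdZl rdZr hZ.
have -> : mulc (fun i j => (Num.sqrt K')%:C *: Z i j)
    (fun i j => (Num.sqrt K')%:C *: Z i j) i j = K'%:C *: mulc Z Z i j.
  rewrite scaler_sumr; apply: eq_bigr => k _.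
  have pZ i' j' : B (Z i' j') by exact: fixed_periph.
  rewrite circZl ?circZr //; last exact: periphZ.
  by rewrite scalerA -rmorphM -expr2 sqr_sqrtr // ltW.
rewrite eZ /Y opprD addrA subrr add0r rmorphN scaleNr opprK scalerA -rmorphM.
by rewrite divff ?gt_eqF // rmorph1 scale1r.
Qed.

(* For [z = sum_k x_k] with [x_k] in the eigenspace of [lam_k], the operators
   [w m = sum_k lam_k^-m x_k] turn the twisted limits defining the modified
   product into limits of [P^m (w m o w' m)], which preserve positivity. *)
Definition rotation (z : F -> F) (w : nat -> F -> F) : Prop :=
  exists n (lam : 'I_n -> R[i]) (x : 'I_n -> F -> F),
  [/\ forall k, `|lam k| = 1 /\ eig (lam k) (x k), z = \sum_k x k &
      forall m, w m = \sum_k lam k ^- m *: x k].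

Lemma rotation_ex z : span z -> exists w, rotation z w.
Proof.
move=> /spanP[n [lam [x [hx ->]]]]; exists (fun m => \sum_k lam k ^- m *: x k).
by exists n, lam, x.
Qed.

Lemma rotation_bounded z w m : rotation z w -> bounded_op (w m).
Proof.
move=> [n [lam [x [hx _ ->]]]]; apply: bounded_sum => k _; apply: boundedZ.
by case: (hx k) => _ [].
Qed.

Lemma rotation_adjoint z w : rotation z w -> rotation z^† (fun m => (w m)^†).
Proof.
move=> rw; have bw m := rotation_bounded m rw; case: rw => n [lam [x [hx ez ew]]].
have bx k : bounded_op (x k) by case: (hx k) => _ [].
exists n, (fun k => conjc (lam k)), (fun k => (x k)^†); split.
- by move=> k; have [h1 h2] := hx k; rewrite normcJ; split=> //; exact: eig_adjoint.
- apply: adjp_adjoint => //; first by rewrite ez; exact: bounded_sum.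
  by rewrite ez; apply: adjp_sum => k _; exact: adjoint_ex.
move=> m; apply: adjp_adjoint => //; rewrite ew; apply: adjp_sum => k _.
rewrite -rmorphXn -fmorphV; apply: adjpZ; first exact: bounded_lin.
exact: adjoint_ex.
Qed.

(** The twist (lam_k mu_l)^-m varies with the pair (k, l) but factors as lam_k^-m mu_l^-m, so the
    double sum of twisted terms is P^m of one composition. *)
Lemma rotation_cvg y z w w' v : rotation y w -> rotation z w' ->
  iter m P (w m \o w' m) v @[m --> \oo] --> circ y z v.
Proof.
move=> [n [lam [x [hx -> ew]]]] [n' [mu [x' [hx' -> ew']]]].
have bx k : bounded_op (x k) by case: (hx k) => _ [].
have bx' k : bounded_op (x' k) by case: (hx' k) => _ [].
have px k : B (x k) by have [h1 h2] := hx k; exact: eig_periph h2.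
have px' k : B (x' k) by have [h1 h2] := hx' k; exact: eig_periph h2.
have e m : iter m P (w m \o w' m) v =
    \sum_k \sum_l ((lam k * mu l) ^- m *: iter m P (x k \o x' l) v).
  have -> : w m \o w' m = \sum_k \sum_l (lam k * mu l) ^- m *: (x k \o x' l).
    apply/funext => u; rewrite ew ew' /= !fct_sumE; apply: eq_bigr => k _.
    rewrite fct_sumE -[LHS]/(lam k ^- m *: x k (\sum_(i < n') (mu i ^- m *: x' i) u)).
    rewrite (lin_sum (bounded_lin (bx k))) scaler_sumr.
    apply: eq_bigr => l _; rewrite !fctE (linZ (bounded_lin (bx k))) scalerA.
    by rewrite exprMn invfM.
  have bxx k l : bounded_op (x k \o x' l) by exact: bounded_comp.
  have bs k l : bounded_op ((lam k * mu l) ^- m *: (x k \o x' l)) by exact: boundedZ.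
  rewrite iter_sum; last by move=> k; exact: bounded_sum.
  rewrite fct_sumE; apply: eq_bigr => k _; rewrite iter_sum // fct_sumE.
  by apply: eq_bigr => l _; rewrite iterZ.
under eq_fun do rewrite e.
rewrite circ_suml //; last exact: periph_sum.
rewrite fct_sumE; apply: cvg_sumr => k _; rewrite circ_sumr // fct_sumE.
apply: cvg_sumr => l _; have [h1 h2] := hx k; have [h3 h4] := hx' l.
exact: circ_eig_cvg.
Qed.

(** * Positivity of Gram matrices and the conditional expectation *)

Lemma psd_gram n (w : 'I_n -> F -> F) : (forall i, bounded_op (w i)) ->
  psd dF (fun i j => (w i)^† \o w j).
Proof.
move=> bw; have aw i := adjoint_ex HF (bw i); split=> [i j|u].
  by apply: adjp_comp => //; exact: adjp_sym.
(* The form at u is the squared norm of the sum of the w_j u_j. *)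
have -> : form dF (fun i j => (w i)^† \o w j) u u =
    rd (\sum_j w j (u j)) (\sum_i w i (u i)).
  rewrite rd_sumr; apply: eq_bigr => i _; rewrite rd_suml; apply: eq_bigr => j _ /=.
  by rewrite rdC -aw rdC.
by rewrite (rdvv HF) sqr_ge0.
Qed.

Lemma span_gram_psd n (z : 'I_n -> F -> F) : (forall i, span (z i)) ->
  psd dF (fun i j => circ (z i)^† (z j)).
Proof.
move=> sz; have /choice[w hw] : forall i, exists w, rotation (z i) w.
  by move=> i; exact: rotation_ex.
apply: (@psd_lim _ _ _ HF _ (fun m i j => iter m P ((w i m)^† \o w j m))).
  move=> i j v /=; apply: (@rotation_cvg _ _ (fun m => (w i m)^†)) => //.
  exact: rotation_adjoint.
have bw i m : bounded_op (w i m) by exact: rotation_bounded (hw i).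
move=> m; apply: iter_psd; last exact: psd_gram.
by move=> i j; apply: bounded_comp => //; exact: adjoint_bounded.
Qed.

(** Positivity extends from the span by density: [circ] is norm continuous, and the form condition
    is closed under pointwise limits of the entries. *)
Lemma periph_gram_psd n (z : 'I_n -> F -> F) : (forall i, B (z i)) ->
  psd dF (fun i j => circ (z i)^† (z j)).
Proof.
move=> bz; have /choice[y hy] : forall p : 'I_n * nat, exists y,
    span y /\ opb (z p.1 - y) p.2.+1%:R^-1.
  move=> p; have e0 : 0 < p.2.+1%:R^-1 :> R by rewrite invr_gt0.
  by have [y sy oy] := periph_approx (bz p.1) e0; exists y.
have sy i N : span (y (i, N)) by case: (hy (i, N)).
have oy i N : opb (z i - y (i, N)) N.+1%:R^-1 by case: (hy (i, N)).
apply: (@psd_lim _ _ _ HF _ (fun N i j => circ (y (i, N))^† (y (j, N)))).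
  move=> i j v; apply: (@circ_cvg (fun N => (y (i, N))^†) (fun N => y (j, N))) => //.
  - exact: periph_adjoint.
  - by move=> N; apply: span_periph; exact: span_adjoint.
  - by move=> N; exact: span_periph.
  move=> N; apply: adjoint_opbB => //; first exact: periph_bounded.
  exact: span_bounded.
by move=> N; exact: span_gram_psd.
Qed.

Lemma expect_conditional_expectation :
  conditional_expectation circ (adjoint dF) (@opnorm R F) B (poisson_boundary P) expect.
Proof.
split.
- by move=> x; exact: expect_eig.
- by move=> a x y; exact: expect_scaleD.
- move=> n _ [Z [bZ ->]].
  (* Z^* o Z is a sum of Gram matrices, one for each row of Z. *)
  pose X i j := \sum_k circ (Z k i)^† (Z k j).
  have bX i j : B (X i j).
    by apply: periph_sum => k _; apply: circ_periph => //; exact: periph_adjoint.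
  have pX : psd dF X by apply: psd_sum => k _; exact: periph_gram_psd.
  have [W [fW hW eW]] := psd_square_root (fun i j => expect_eig (bX i j)) (expect_psd bX pX).
  exists (\matrix_(i, j) W i j); split=> [i j|]; first by rewrite mxE; exact: fW.
  apply/matrixP => i j; rewrite !mxE -/(X i j) eW; apply: eq_bigr => k _; rewrite !mxE.
  (* As W is self-adjoint, the adjoint of its (k, i) entry is its (i, k) entry, which identifies W o
     W with W^* o W. *)
  by rewrite (@adjp_adjoint _ _ _ HF (W k i) (W i k)) //; case: (fW k i).
- move=> x hx; have bx := periph_bounded hx.
  apply: opnorm_le; first exact: opnorm_ge0.
  by apply: expect_opb => //; [exact: opnorm_ge0|exact: opnorm_opb].
- by move=> x; exact: expect_fixed.
Qed.

End PeripheralBoundary.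

(** * Creation operators of unit vectors are isometries *)

Section CreationOperators.
Variables (R : realType) (H F : completeNormedModType R[i]).
Variables (dH : {dot H for Num.Def.conjC}) (dF : {dot F for Num.Def.conjC}).
Hypothesis HF : hilbert dF.
Variables (tens : seq H -> F) (Htens : full_fock dH dF tens).

(** The functional is real-valued and only additive, as real parts of inner products are; the
    vanishing must therefore be tested on all complex multiples of elementary tensors before density
    and boundedness apply. *)
Lemma fock_dense (g : F -> R) (M : R) : 0 <= M ->
  (forall u v, g (u + v) = g u + g v) -> (forall u, `|g u| <= M * nr u) ->
  (forall a s, g (a *: tens s) = 0) -> forall u, g u = 0.
Proof.
move=> M0 gD gM gt u; have [_ _ dense] := Htens.
have g0 : g 0 = 0 by have := gD 0 0; rewrite addr0; lra.
have gN v : g (- v) = - g v by have := gD v (- v); rewrite subrr g0; lra.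
have gspan v : lspan (range tens) v -> g v = 0.
  move=> [n [c [x [hx ->]]]]; elim/big_ind: _ => //.
    by move=> y z hy hz; rewrite gD hy hz addr0.
  by move=> k _; have [s _ <-] := hx k.
apply/eqP; rewrite -normr_eq0 eq_le normr_ge0 andbT; apply/ler_addgt0Pl => e e0.
rewrite addr0; have d0 : 0 < e / (M + 1) by rewrite divr_gt0 // ltr_wpDl.
have : closure (lspan (range tens)) u by rewrite dense.
have dC : 0 < (e / (M + 1))%:C by rewrite ltcR.
move=> /(_ _ (nbhsx_ballx u _ dC))[v [/gspan gv]].
rewrite -ball_normE /= normE ltcR => huv.
have -> : g u = g (u - v) by rewrite gD gN gv subr0.
apply: (le_trans (gM _)); apply: (@le_trans _ _ (M * (e / (M + 1)))).
  by rewrite ler_wpM2l // ltW.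
rewrite mulrCA ler_piMr ?(ltW e0) // ler_pdivrMr ?ltr_wpDl //.
by rewrite mul1r lerDl.
Qed.

(** On elementary tensors, prepending xi multiplies the inner product by <xi, xi> = 1. Density
    extends the identity one variable at a time. *)
Lemma creation_isometry (xi : H) (L : F -> F) : dH xi xi = 1 -> bounded_op L ->
  (forall s, L (tens s) = tens (xi :: s)) -> forall u v, rd dF (L u) (L v) = rd dF u v.
Proof.
move=> hxi bL hL; have [_ ip _] := Htens.
have /bounded_opP[lL [M M0 hM]] := bL.
have bound u v : `|rd dF (L u) (L v) - rd dF u v| <= (M * (M * nr v) + nr v) * nr u.
  rewrite (le_trans (ler_normB _ _)) // mulrDl lerD //; last first.
    by rewrite mulrC (abs_rd_le HF).
  rewrite (le_trans (abs_rd_le HF _ _)) //.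
  have -> : M * (M * nr v) * nr u = (M * nr u) * (M * nr v) by ring.
  by apply: ler_pM; rewrite ?nr_ge0 //; exact: hM.
have K0 (v : F) : 0 <= M * (M * nr v) + nr v by rewrite addr_ge0 ?mulr_ge0 ?nr_ge0.
have tt s t a : rd dF (L (a *: tens s)) (L (tens t)) - rd dF (a *: tens s) (tens t) = 0.
  rewrite (linZ lL) !hL /rd !linearZl_LR /= !ip /= eqSS.
  by case: ifP => _; rewrite ?big_cons /= ?hxi ?mul1r subrr.
have ut u t : rd dF (L u) (L (tens t)) - rd dF u (tens t) = 0.
  move: u; apply: (@fock_dense
    (fun u => rd dF (L u) (L (tens t)) - rd dF u (tens t)) _ (K0 (tens t))).
  - by move=> w w'; rewrite (linD lL) !rdDl; lra.
  - by move=> w; exact: bound.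
  by move=> a s; exact: tt.
move=> u v; apply/eqP; rewrite -subr_eq0; apply/eqP.
move: v; apply: (@fock_dense (fun v => rd dF (L u) (L v) - rd dF u v) _ (K0 u)).
- by move=> w w'; rewrite (linD lL) !rdDr; lra.
- by move=> w; rewrite rdC [rd dF u w]rdC; exact: bound.
(* The scalar moves to the first variable, where the identity already holds for every vector. *)
by move=> a s; rewrite (linZ lL) !rdZrJ -(linZ lL); exact: ut.
Qed.

End CreationOperators.

Theorem proposition3p11 (R : realType) (H F : completeNormedModType R[i])
  (dH : {dot H for Num.Def.conjC}) (dF : {dot F for Num.Def.conjC})
  (HH : hilbert dH) (HF : hilbert dF)
  (Theta : set nat)
  (HTheta : (exists2 n : nat, (1 < n)%N & Theta = `I_n) \/ Theta = setT)
  (e : nat -> H) (He : orthonormal_basis dH Theta e)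
  (tens : seq H -> F) (Htens : full_fock dH dF tens)
  (l : H -> F -> F) (Hl : left_creation tens l)
  (omega : nat -> R) (Homega : forall i, Theta i -> 0 < omega i)
  (Homega1 : \sum_(i < n | (i : nat) \in Theta) omega i @[n --> \oo] --> (1 : R))
  (circ : (F -> F) -> (F -> F) -> (F -> F))
  (Hcirc : modified_choi_effros
             (P_omega dF Theta omega (fun i => l (e i))) circ) :
  exists E : (F -> F) -> (F -> F),
    conditional_expectation circ (adjoint dF) (@opnorm R F)
      (peripheral_boundary (P_omega dF Theta omega (fun i => l (e i))))
      (poisson_boundary (P_omega dF Theta omega (fun i => l (e i)))) E.
Proof.
pose L i := l (e i).
have bL i : Theta i -> bounded_op (L i) by move=> _; case: (Hl (e i)).
have iL i : Theta i -> forall u v, rd dF (L i u) (L i v) = rd dF u v.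
  move=> hi; apply: (creation_isometry (xi := e i) HF Htens _ (bL i hi)).
    by have [/(_ i i hi hi) -> _] := He; rewrite eqxx.
  by case: (Hl (e i)).
have Pb := @P_bounded _ _ _ HF _ _ L Homega Homega1 bL iL.
exists (expect (P_omega dF Theta omega L)).
apply: (expect_conditional_expectation HF).
- exact: Pb.
- by move=> x M; exact: (P_opb HF).
- by move=> a x y; exact: (P_scaleD HF).
- exact: (P_id HF).
- by move=> x y M u; exact: (P_normal HF).
- by move=> x y; exact: (P_adjp HF).
- by move=> n X M; exact: (P_wbound HF).
- by move=> n X; exact: (P_psd HF).
- exact: Hcirc.
Qed.
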